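(* Let $T>0$, $d\in\mathbb{N}$, $x_0\in\mathbb{R}^d$, let $\pi$ be a partition of $[0,T]$, let $0\le\alpha'<\alpha\le 1$, $\beta>0$, $\gamma\ge 1$, let $\widehat{\mathcal C}^\pi$ carry the metric $d_{\alpha'}$, and let $$\psi\colon\widehat{\mathcal C}^\pi\to(0,\infty),\qquad \psi(\widehat X^\pi):=\exp\bigl(\beta\|\widehat X^\pi\|_\alpha^\gamma\bigr).$$ Then the linear span of the set $$\Bigl\{\widehat X^\pi\mapsto\langle e_I,\widehat{\mathbb X}^\pi_T\rangle : I\in\{0,\ldots,d\}^N,\ N\in\mathbb{N}_0\Bigr\}$$ is dense in $\mathcal B_\psi(\widehat{\mathcal C}^\pi)$; that is, for every $f\in\mathcal B_\psi(\widehat{\mathcal C}^\pi)$ and every $\varepsilon>0$ there exists a linear function $\boldsymbol\ell$ of the form $\boldsymbol\ell(\widehat{\mathbb X}^\pi_T)=\sum_{0\le|I|\le N}\ell_I\langle e_I,\widehat{\mathbb X}^\pi_T\rangle$, with some $N\in\mathbb{N}_0$ and $\ell_I\in\mathbb{R}$, such that $$\sup_{\widehat X^\pi\in\widehat{\mathcal C}^\pi}\frac{|f(\widehat X^\pi)-\boldsymbol\ell(\widehat{\mathbb X}^\pi_T)|}{\psi(\widehat X^\pi)}<\varepsilon .$$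
   Context: Path space. Let $\pi=\{0=t_0<\cdots<t_n=T\}$ be a partition of $[0,T]$ and $x_0\in\mathbb{R}^d$ a fixed initial value. For $X\colon\pi\to\mathbb{R}^d$ with $X_0=x_0$, $X^\pi\colon[0,T]\to\mathbb{R}^d$ is its piecewise linear interpolation, $X^\pi_t=X_{t_k}+\frac{t-t_k}{t_{k+1}-t_k}(X_{t_{k+1}}-X_{t_k})$ for $t\in[t_k,t_{k+1}]$, and $\widehat X^\pi\colon[0,T]\to\mathbb{R}^{d+1}$, $\widehat X^\pi_t=(t,X^\pi_t)$, is the time-extended path. $\widehat{\mathcal C}^\pi$ denotes the set of all such $\widehat X^\pi$, $X\colon\pi\to\mathbb{R}^d$, $X_0=x_0$. Norms. With $|\cdot|$ the Euclidean norm and $Y_{s,t}:=Y_t-Y_s$, set $\|Y\|_\alpha:=\sup_{0\le s<t\le T}\frac{|Y_{s,t}|}{|t-s|^\alpha}$ and $d_{\alpha'}(Y,Z):=\sup_{0\le s<t\le T}\frac{|Y_{s,t}-Z_{s,t}|}{|t-s|^{\alpha'}}$. Signature. The coordinates of $\mathbb{R}^{d+1}$ are indexed by $0,1,\ldots,d$, with index $0$ the time coordinate, and $e_0,\dots,e_d$ is the canonical basis. For a multi-index $I=(i_1,\ldots,i_k)\in\{0,\ldots,d\}^k$, $|I|=k$ and $e_I=e_{i_1}\otimes\cdots\otimes e_{i_k}$. $\widehat{\mathbb X}^\pi_t$ is the signature of $\widehat X^\pi$ on $[0,t]$, i.e. the element of the extended tensor algebra $T((\mathbb{R}^{d+1}))=\prod_{k\ge0}(\mathbb{R}^{d+1})^{\otimes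 k}$ with coordinates $\langle e_I,\widehat{\mathbb X}^\pi_t\rangle=\int_{0<u_1<\cdots<u_k<t}d\widehat X^{\pi,i_1}_{u_1}\cdots d\widehat X^{\pi,i_k}_{u_k}$ (Riemann–Stieltjes integrals), and $\langle e_\emptyset,\widehat{\mathbb X}^\pi_t\rangle=1$. Weighted function space. For a completely regular Hausdorff space $E$ and $\psi\colon E\to(0,\infty)$ with $\psi^{-1}((0,R])$ compact for all $R>0$ (an admissible weight function), let $B_\psi(E)=\{f\colon E\to\mathbb{R}:\sup_{x\in E}|f(x)|/\psi(x)<\infty\}$ with norm $\|f\|_{\mathcal B_\psi(E)}=\sup_{x\in E}|f(x)|/\psi(x)$; $\mathcal B_\psi(E)$ is the closure in $B_\psi(E)$, with respect to this norm, of the space $C_b(E)$ of bounded continuous real functions on $E$. *)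

(* Defs.v *)
From HB Require Import structures.
From mathcomp Require Import all_boot all_order all_algebra.
From mathcomp Require Import all_classical all_reals all_analysis.
From mathcomp Require Import ring lra zify.

Set Implicit Arguments.
Unset Strict Implicit.
Unset Printing Implicit Defensive.

Import Order.TTheory GRing.Theory Num.Theory.
Import numFieldNormedType.Exports.

Local Open Scope classical_set_scope.
Local Open Scope ring_scope.

Section WeightedSpace.
Context {R : realType}.

Definition weighted_norm (E : Type) (psi : E -> R) (f : E -> R) : \bar R :=
  ereal_sup [set (`|f x| / psi x)%:E | x in [set: E]].

Definition bounded_continuous (E : topologicalType) : set (E -> R) :=
  [set f | continuous f /\ exists M : R, forall x, `|f x| <= M].

Definition weighted_bounded (E : Type) (psi : E -> R) : set (E -> R) :=
  [set f | (weighted_norm psi f < +oo)%E].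

Definition weighted_space (E : topologicalType) (psi : E -> R) :
    set (E -> R) :=
  [set f | weighted_bounded psi f /\
    forall eps : R, 0 < eps -> exists2 g : E -> R, bounded_continuous g &
      (weighted_norm psi (fun x => f x - g x)%R < eps%:E)%E].

(* A is a subset of weighted_space psi, dense for the weighted norm. *)
Definition weighted_dense (E : topologicalType) (psi : E -> R)
    (A : set (E -> R)) : Prop :=
  A `<=` weighted_space psi /\
  forall f, weighted_space psi f -> forall eps : R, 0 < eps ->
    exists2 g, A g & (weighted_norm psi (fun x => f x - g x)%R < eps%:E)%E.

End WeightedSpace.

Arguments weighted_dense {R} E psi A.

Section HolderPaths.
Context {R : realType}.

(* The canonical norm `|v| of MathComp-Analysis on matrices is the maximum
   norm, not the Euclidean one. *)
Definition enorm (n : nat) (v : 'rV[R]_n) : R :=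
  Num.sqrt (\sum_(i < n) v 0 i ^+ 2).

Definition time_pairs (T : R) : set (R * R) :=
  [set st | [/\ 0 <= st.1, st.1 < st.2 & st.2 <= T]].

Definition holder_norm (n : nat) (T alpha : R) (Y : R -> 'rV[R]_n) : \bar R :=
  ereal_sup [set (enorm (Y st.2 - Y st.1) / `|st.2 - st.1| `^ alpha)%:E
            | st in time_pairs T].

Definition holder_dist (n : nat) (T alpha : R) (Y Z : R -> 'rV[R]_n) : \bar R :=
  ereal_sup [set (enorm ((Y st.2 - Y st.1) - (Z st.2 - Z st.1))
                    / `|st.2 - st.1| `^ alpha)%:E
            | st in time_pairs T].

Lemma enormN n (v : 'rV[R]_n) : enorm (- v) = enorm v.
Proof.
by rewrite /enorm; congr Num.sqrt; apply: eq_bigr => i _; rewrite mxE sqrrN.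
Qed.

Lemma enorm0 n : enorm (0 : 'rV[R]_n) = 0.
Proof.
by rewrite /enorm big1 ?sqrtr0// => i _; rewrite mxE expr0n.
Qed.

Lemma enorm_ge0 n (v : 'rV[R]_n) : 0 <= enorm v.
Proof. exact: sqrtr_ge0. Qed.

Lemma enormZ n (c : R) (v : 'rV[R]_n) : enorm (c *: v) = `|c| * enorm v.
Proof.
rewrite /enorm -sqrtr_sqr -sqrtrM ?sqr_ge0//; congr Num.sqrt.
by rewrite mulr_sumr; apply: eq_bigr => i _; rewrite mxE exprMn.
Qed.

Lemma enorm_eq0 n (v : 'rV[R]_n) : enorm v = 0 -> v = 0.
Proof.
move=> /eqP; rewrite sqrtr_eq0 => v0; apply/rowP => i; rewrite mxE.
apply/eqP; rewrite -sqrf_eq0; apply/eqP.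
have S0 : \sum_i v 0 i ^+ 2 = 0.
  by apply/eqP; rewrite eq_le v0; apply: sumr_ge0 => j _; exact: sqr_ge0.
by apply: (psumr_eq0P _ S0) => // j _; exact: sqr_ge0.
Qed.

Lemma enorm_row_mx m n (u : 'rV[R]_m) (v : 'rV[R]_n) :
  enorm (row_mx u v) = Num.sqrt (enorm u ^+ 2 + enorm v ^+ 2).
Proof.
have S0 k (w : 'rV[R]_k) : 0 <= \sum_i w 0 i ^+ 2.
  by apply: sumr_ge0 => i _; exact: sqr_ge0.
rewrite /enorm !sqr_sqrtr// big_split_ord/=; congr (Num.sqrt (_ + _)).
  by apply: eq_bigr => i _; rewrite row_mxEl.
by apply: eq_bigr => i _; rewrite row_mxEr.
Qed.

Lemma sum_cauchy_schwarz (I : Type) (r : seq I) (a b : I -> R) :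
  (\sum_(i <- r) a i * b i) ^+ 2
    <= (\sum_(i <- r) a i ^+ 2) * (\sum_(i <- r) b i ^+ 2).
Proof.
elim: r => [|i r IH]; first by rewrite !big_nil expr0n mulr0.
rewrite !big_cons.
set A := \sum_(j <- r) a j ^+ 2 in IH *.
set B := \sum_(j <- r) b j ^+ 2 in IH *.
set C := \sum_(j <- r) a j * b j in IH *.
have A0 : 0 <= A by apply: sumr_ge0 => j _; exact: sqr_ge0.
have B0 : 0 <= B by apply: sumr_ge0 => j _; exact: sqr_ge0.
suff : 2 * (a i * b i) * C <= a i ^+ 2 * B + b i ^+ 2 * A by move: IH; nra.
have [u_ge0 v_ge0] : 0 <= a i ^+ 2 * B /\ 0 <= b i ^+ 2 * A.
  by split; apply: mulr_ge0 => //; exact: sqr_ge0.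
apply: le_trans (ler_norm _) _.
rewrite -[leRHS]ger0_norm ?addr_ge0// -ler_sqr ?nnegrE//.
rewrite !real_normK ?num_real//.
have : (2 * (a i * b i) * C) ^+ 2 <= 4 * (a i ^+ 2 * B) * (b i ^+ 2 * A).
  rewrite [leLHS](_ : _ = (2 * (a i * b i)) ^+ 2 * C ^+ 2); last by ring.
  rewrite [leRHS](_ : _ = (2 * (a i * b i)) ^+ 2 * (A * B)); last by ring.
  by apply: ler_wpM2l => //; exact: sqr_ge0.
by move/le_trans; apply; have := sqr_ge0 (a i ^+ 2 * B - b i ^+ 2 * A); nra.
Qed.

Lemma ler_enormD n (u v : 'rV[R]_n) : enorm (u + v) <= enorm u + enorm v.
Proof.
have S0 (w : 'rV[R]_n) : 0 <= \sum_i w 0 i ^+ 2.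
  by apply: sumr_ge0 => i _; exact: sqr_ge0.
rewrite /enorm -ler_sqr ?nnegrE ?addr_ge0 ?sqrtr_ge0//.
rewrite sqrrD !sqr_sqrtr//.
rewrite (_ : \sum_i (u + v) 0 i ^+ 2 = \sum_i u 0 i ^+ 2
    + (\sum_i u 0 i * v 0 i) *+ 2 + \sum_i v 0 i ^+ 2); last first.
  rewrite -sumrMnl -!big_split/=; apply: eq_bigr => i _.
  by rewrite mxE sqrrD.
rewrite lerD2r lerD2l lerMn2r/= -sqrtrM//.
apply: le_trans (ler_norm _) _; rewrite -sqrtr_sqr ler_wsqrtr//.
exact: sum_cauchy_schwarz.
Qed.

Lemma holder_distxx n (T a e : R) (Y : R -> 'rV[R]_n) :
  0 < e -> (holder_dist T a Y Y < e%:E)%E.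
Proof.
move=> e0; apply: (@le_lt_trans _ _ 0%E); last by rewrite lte_fin.
by apply: ge_ereal_sup => _ [st _ <-]; rewrite subrr enorm0 mul0r.
Qed.

Lemma holder_distC n (T a : R) (Y Z : R -> 'rV[R]_n) :
  holder_dist T a Y Z = holder_dist T a Z Y.
Proof.
rewrite /holder_dist; congr ereal_sup; apply: eq_imagel => st _.
by rewrite -enormN opprB.
Qed.

Lemma holder_dist_triangle n (T a e1 e2 : R) (X Y Z : R -> 'rV[R]_n) :
  (holder_dist T a X Y < e1%:E)%E -> (holder_dist T a Y Z < e2%:E)%E ->
  (holder_dist T a X Z < (e1 + e2)%:E)%E.
Proof.
move=> h1 h2; apply: (@le_lt_trans _ _ (holder_dist T a X Y + holder_dist T a Y Z)%E).
  apply: ge_ereal_sup => _ [st Tst <-].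
  apply: (@le_trans _ _ (
     (enorm ((X st.2 - X st.1) - (Y st.2 - Y st.1))
        / `|st.2 - st.1| `^ a)%:E
   + (enorm ((Y st.2 - Y st.1) - (Z st.2 - Z st.1))
        / `|st.2 - st.1| `^ a)%:E)%E).
    rewrite -EFinD lee_fin -mulrDl ler_wpM2r ?invr_ge0 ?powR_ge0//.
    by apply: le_trans (ler_enormD _ _); rewrite addrA subrK.
  by apply: leeD; apply: ereal_sup_ubound; exists st.
by rewrite EFinD; exact: lteD.
Qed.

End HolderPaths.

Section PathSpace.
Context {R : realType}.

(* The partition {0 = t_0 < ... < t_n = T} is the sequence 0 :: s with
   itv_partition 0 T s, so n = size s; only the values of X at the points of
   the partition are used.  Outside [0, T] the first and last affine pieces are
   prolonged, so that the total function is determined by its values on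
   [0, T]. *)
Definition interpolation (d : nat) (s : seq R) (X : R -> 'rV[R]_d) (t : R) :
    'rV[R]_d :=
  let k := minn (find (fun u => t <= u) s) (size s).-1 in
  let u := nth 0 (0 :: s) k in
  let v := nth 0 (0 :: s) k.+1 in
  X u + ((t - u) / (v - u)) *: (X v - X u).

Lemma interpolationE (d : nat) (T : R) (s : seq R) (X : R -> 'rV[R]_d)
    (k : nat) (t : R) (u := nth 0 (0 :: s) k) (v := nth 0 (0 :: s) k.+1) :
  itv_partition 0 T s -> (k < size s)%N -> u <= t <= v ->
  interpolation s X t = X u + ((t - u) / (v - u)) *: (X v - X u).
Proof.
move=> [s_path _] ks /andP[ut tv]; rewrite /u /v in ut tv *.
have mono i j : (i < j)%N -> (j <= size s)%N ->
    nth 0 (0 :: s) i < nth 0 (0 :: s) j.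
  move=> ij js; have s_sorted : sorted <%O (0 :: s) by [].
  apply: (sorted_ltn_nth (@lt_trans _ _) 0 s_sorted) => //.
  by rewrite inE/= ltnS (leq_trans (ltnW ij)).
rewrite /interpolation; set j := find _ s.
have jk : (j <= k)%N.
  by rewrite leqNgt; apply/negP => kj; have := before_find 0 kj; rewrite tv.
have js : (j < size s)%N by rewrite (leq_ltn_trans jk).
have -> : minn j (size s).-1 = j by apply/minn_idPl; lia.
have tj : t <= nth 0 s j by apply: (@nth_find _ 0 (fun u => t <= u)); rewrite has_find.
clearbody j; move: jk; rewrite leq_eqVlt => /orP[/eqP->//|jk].
have [kE|kj] := eqVneq k j.+1; last first.
  have lt1 : nth 0 (0 :: s) j.+1 < nth 0 (0 :: s) k.
    by apply: mono (ltnW ks); lia.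
  by have := lt_le_trans lt1 (le_trans ut tj); rewrite ltxx.
have {ut tv} tE : t = nth 0 s j.
  by apply/eqP; rewrite eq_le tj; move: ut; rewrite kE.
rewrite kE /= tE.
rewrite subrr mul0r scale0r addr0 divff; first by rewrite scale1r addrC subrK.
by rewrite subr_eq0 gt_eqF// (mono j j.+1).
Qed.

Lemma partition_size_gt0 (T : R) (s : seq R) :
  0 < T -> itv_partition 0 T s -> (0 < size s)%N.
Proof. by case: s => // T0 /itv_partition_nil TE; rewrite TE ltxx in T0. Qed.

Lemma partition_node_itv (T : R) (s : seq R) (k : nat) :
  itv_partition 0 T s -> (k <= size s)%N -> 0 <= nth 0 (0 :: s) k <= T.
Proof.
move=> [s_path /eqP s_last] ks; have s_sorted : sorted <=%O (0 :: s).
  by apply: (sub_path _ s_path) => ? ?; exact: ltW.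
have mono := sorted_leq_nth (@le_trans _ _) (@lexx _ _) 0 s_sorted.
have -> : T = nth 0 (0 :: s) (size s) by rewrite -s_last -(nth_last 0) /=; case: s {s_path s_last ks s_sorted mono}.
by apply/andP; split; [apply: (mono 0%N k) | apply: (mono k (size s))];
  rewrite ?inE //= ltnS.
Qed.

Lemma interpolation_node (d : nat) (T : R) (s : seq R) (X : R -> 'rV[R]_d)
    (k : nat) : 0 < T -> itv_partition 0 T s -> (k <= size s)%N ->
  interpolation s X (nth 0 (0 :: s) k) = X (nth 0 (0 :: s) k).
Proof.
move=> T0 s_part; have [s_path _] := s_part.
have step j : (j < size s)%N -> nth 0 (0 :: s) j < nth 0 (0 :: s) j.+1.
  by move=> js; apply/(pathP 0).
case: k => [|k] ks.
  have s0 := partition_size_gt0 T0 s_part.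
  rewrite (interpolationE (k := 0) X s_part)// ?lexx ?ltW ?step//.
  by rewrite subrr mul0r scale0r addr0.
rewrite (interpolationE (k := k) X s_part)// ?lexx ?ltW ?step//.
rewrite divff ?subr_eq0 ?gt_eqF ?step// scale1r.
by rewrite addrC subrK.
Qed.

Definition time_extension (d : nat) (X : R -> 'rV[R]_d) (t : R) :
    'rV[R]_(1 + d) := row_mx t%:M (X t).

(* The parameters T and alpha' do not restrict the paths; they fix the metric
   d_alpha' put on them. *)
Record path_space (T alpha' : R) (d : nat) (x0 : 'rV[R]_d) (s : seq R) :=
  PathSpace {
    path_fun :> R -> 'rV[R]_(1 + d);
    path_funP : exists2 X : R -> 'rV[R]_d, X 0 = x0 &
      path_fun = time_extension (interpolation s X) }.

End PathSpace.

Section PathMetric.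
Context {R : realType} (T alpha' : R) (d : nat) (x0 : 'rV[R]_d) (s : seq R).
Local Notation E := (path_space T alpha' x0 s).

HB.instance Definition _ := gen_eqMixin E.
HB.instance Definition _ := gen_choiceMixin E.

Definition path_ball (x : E) (e : R) (y : E) : Prop :=
  (holder_dist T alpha' x y < e%:E)%E.

Lemma path_ball_center x (e : R) : 0 < e -> path_ball x e x.
Proof. exact: holder_distxx. Qed.

Lemma path_ball_sym x y e : path_ball x e y -> path_ball y e x.
Proof. by rewrite /path_ball holder_distC. Qed.

Lemma path_ball_triangle x y z e1 e2 :
  path_ball x e1 y -> path_ball y e2 z -> path_ball x (e1 + e2) z.
Proof. exact: holder_dist_triangle. Qed.

HB.instance Definition _ := hasNbhs.Build E (nbhs_ (entourage_ path_ball)).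
HB.instance Definition _ := Nbhs_isPseudoMetric.Build R E
  erefl path_ball_center path_ball_sym path_ball_triangle erefl.

End PathMetric.

(* On path_space both suprema are finite, and d_alpha' separates points. *)
Section HolderFinite.
Context {R : realType}.

Lemma lipschitz_glue (n : nat) (L : R) (f : R -> 'rV[R]_n) (s : seq R) (a : R) :
  path <%O a s ->
  (forall k u v, (k < size s)%N -> nth 0 (a :: s) k <= u -> u <= v ->
     v <= nth 0 (a :: s) k.+1 -> enorm (f v - f u) <= L * (v - u)) ->
  forall u v, a <= u -> u <= v -> v <= last a s ->
    enorm (f v - f u) <= L * (v - u).
Proof.
elim: s a => [a _ _ u v /= au uv va|b s IH a /= /andP[ab bs] H u v au uv vl].
  have -> : u = v by apply/eqP; rewrite eq_le uv (le_trans va).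
  by rewrite !subrr enorm0 mulr0.
have {}IH := IH b bs (fun k => H k.+1).
have [vb|bv] := leP v b; first exact: (H 0%N).
have [bu|ub] := leP b u; first exact: IH.
have -> : f v - f u = (f v - f b) + (f b - f u) by rewrite addrA subrK.
have -> : L * (v - u) = L * (v - b) + L * (b - u) by ring.
apply: le_trans (ler_enormD _ _) _; apply: lerD; first by rewrite IH// ltW.
by apply: (H 0%N) => //; exact: ltW.
Qed.

Lemma interpolation_lipschitz (d : nat) (T : R) (s : seq R) (X : R -> 'rV[R]_d) :
  itv_partition 0 T s -> exists2 L, 0 <= L &
  forall u v, 0 <= u -> u <= v -> v <= T ->
    enorm (interpolation s X v - interpolation s X u) <= L * (v - u).
Proof.
move=> s_part; have [s_path /eqP s_last] := s_part.
pose t k := nth 0 (0 :: s) k.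
pose c k := enorm (X (t k.+1) - X (t k)) / `|t k.+1 - t k|.
have c0 k : 0 <= c k by rewrite divr_ge0 ?enorm_ge0.
exists (\sum_(k < size s) c k); first exact: sumr_ge0.
move=> u v u0 uv vT; apply: (lipschitz_glue s_path) => //; last by rewrite s_last.
move=> {u v u0 uv vT} k u v ks ku uv vk.
rewrite !(interpolationE (k := k) X s_part ks) ?ku ?vk ?(le_trans ku) ?(le_trans uv)//.
rewrite opprD addrACA subrr add0r -scalerBl enormZ.
rewrite -/(t k) -/(t k.+1) -mulrBl normrM normfV.
rewrite (_ : v - t k - (u - t k) = v - u); last by ring.
rewrite ger0_norm ?subr_ge0// -mulrA mulrC ler_wpM2r ?subr_ge0//.
rewrite mulrC (bigD1 (Ordinal ks))//= lerDl; exact: sumr_ge0.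
Qed.

Lemma time_extension_lipschitz (d : nat) (T : R) (s : seq R)
    (X : R -> 'rV[R]_d) :
  itv_partition 0 T s -> exists2 L, 0 <= L &
  forall u v, 0 <= u -> u <= v -> v <= T ->
    enorm (time_extension (interpolation s X) v
           - time_extension (interpolation s X) u) <= L * (v - u).
Proof.
move=> /(interpolation_lipschitz X)[L L0 HL]; exists (1 + L).
  by rewrite addr_ge0.
move=> u v u0 uv vT; rewrite /time_extension opp_row_mx add_row_mx.
have e1 (x : R) : enorm (x%:M : 'rV[R]_1) = `|x|.
  by rewrite /enorm big_ord1 mxE eqxx mulr1n sqrtr_sqr.
rewrite enorm_row_mx -raddfB/= e1.
apply: (@le_trans _ _ (`|v - u|
  + enorm (interpolation s X v - interpolation s X u))).
  set b := enorm (interpolation s X v - interpolation s X u).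
  have a0 : 0 <= `|v - u| by []; have b0 : 0 <= b := enorm_ge0 _.
  move: a0; set a := `|v - u| => a0; rewrite -ler_sqr ?nnegrE ?addr_ge0//.
  by rewrite sqr_sqrtr; nra.
by rewrite ger0_norm ?subr_ge0// mulrDl mul1r lerD2l HL.
Qed.

Context (T alpha' : R) (d : nat) (x0 : 'rV[R]_d) (s : seq R).
Context (T_gt0 : 0 < T) (s_part : itv_partition 0 T s).
Local Notation E := (path_space T alpha' x0 s).

Lemma holder_sup_fin (a : R) (f : R * R -> R) (L : R) : a <= 1 -> 0 <= L ->
  (forall st, time_pairs T st -> 0 <= f st <= L * (st.2 - st.1)) ->
  ereal_sup [set (f st / `|st.2 - st.1| `^ a)%:E | st in time_pairs T]
    \is a fin_num.
Proof.
move=> a1 L0 Hf; rewrite ge0_fin_numE; last first.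
  have T01 : time_pairs T (0, T) by split.
  apply: (@le_trans _ _ (f (0, T) / `|T - 0| `^ a)%:E).
    by rewrite lee_fin divr_ge0 ?powR_ge0//; case/andP: (Hf _ T01).
  by apply: ereal_sup_ubound; exists (0, T).
apply: (@le_lt_trans _ _ (L * T `^ (1 - a))%:E); last exact: ltry.
apply: ge_ereal_sup => _ [st Tst <-]; rewrite lee_fin.
have [st0 st12 stT] := Tst; have /andP[_ fL] := Hf _ Tst.
have st_gt0 : 0 < st.2 - st.1 by rewrite subr_gt0.
rewrite ger0_norm ?(ltW st_gt0)// ler_pdivrMr ?powR_gt0//.
rewrite (le_trans fL)// -mulrA ler_wpM2l//.
rewrite -[leLHS]powRr1 ?(ltW st_gt0)// -{1}(subrK a 1) powRD; last first.
  by apply/implyP => _; rewrite gt_eqF.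
rewrite ler_wpM2r ?powR_ge0// ge0_ler_powR ?subr_ge0 ?nnegrE ?(ltW st_gt0)//.
  exact: ltW.
by rewrite lerBlDr (le_trans stT)// lerDl.
Qed.

Lemma holder_norm_fin (a : R) (x : E) : a <= 1 ->
  holder_norm T a x \is a fin_num.
Proof.
move=> a1; have [X _ ->] := path_funP x.
have [L L0 HL] := time_extension_lipschitz X s_part.
apply: (holder_sup_fin a1 L0) => st [? ? ?].
by rewrite enorm_ge0 HL// ltW.
Qed.

Lemma holder_dist_fin (a : R) (x y : E) : a <= 1 ->
  holder_dist T a x y \is a fin_num.
Proof.
move=> a1; have [X _ ->] := path_funP x; have [Y _ ->] := path_funP y.
have [L L0 HL] := time_extension_lipschitz X s_part.
have [M M0 HM] := time_extension_lipschitz Y s_part.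
apply: (@holder_sup_fin a _ (L + M)) => //; first exact: addr_ge0.
move=> st [? ? ?]; rewrite enorm_ge0 (le_trans (ler_enormD _ _))//.
by rewrite enormN mulrDl; apply: lerD; [apply: HL|apply: HM] => //; exact: ltW.
Qed.

Lemma holder_dist_eq0 (a : R) (x y : E) :
  holder_dist T a x y = 0%E -> x = y.
Proof.
case: x y => [x [X X0 xE]] [y [Y Y0 yE]] /= xy0.
suff xy : x = y.
  by case: _ / xy (ex_intro2 _ _ Y Y0 yE) => ?; congr PathSpace; exact: Prop_irrelevance.
have x00 : x 0 = y 0.
  rewrite xE yE /time_extension; congr row_mx.
  by rewrite !(interpolation_node (k := 0) _ T_gt0 s_part)//= X0 Y0.
have xyT t : 0 <= t <= T -> x t = y t.
  move=> /andP[]; rewrite le_eqVlt => /orP[/eqP<-//|t0 tT].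
  have : (enorm (x t - x 0 - (y t - y 0)) / `|t - 0| `^ a <= 0).
    rewrite -lee_fin -[leRHS]xy0; apply: ereal_sup_ubound.
    by exists (0, t).
  rewrite pmulr_lle0 ?invr_gt0 ?powR_gt0 ?normr_gt0 ?subr0 ?gt_eqF// => le0.
  have /enorm_eq0 : enorm (x t - x 0 - (y t - y 0)) = 0.
    by apply/eqP; rewrite eq_le le0 enorm_ge0.
  by rewrite x00 opprB addrA subrK => /eqP; rewrite subr_eq0 => /eqP.
have XY k : (k <= size s)%N -> X (nth 0 (0 :: s) k) = Y (nth 0 (0 :: s) k).
  move=> ks; rewrite -(interpolation_node X T_gt0 s_part ks) -(interpolation_node Y T_gt0 s_part ks).
  have := xyT _ (partition_node_itv s_part ks).
  by rewrite xE yE /time_extension => /eq_row_mx[].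
rewrite xE yE; apply/funext => t; congr row_mx; rewrite /interpolation.
have s_gt0 := partition_size_gt0 T_gt0 s_part.
rewrite !XY//.
  by rewrite -ltnS (leq_trans _ (_ : (size s).-1.+2 <= _)%N)// ?ltnS ?geq_minr// prednK.
by rewrite (leq_trans (geq_minr _ _)) ?leq_pred.
Qed.

End HolderFinite.

Section Signature.
Context {R : realType}.

Definition is_RS_integral (f g : R -> R) (a b l : R) : Prop :=
  forall eps : R, 0 < eps -> exists2 delta : R, 0 < delta &
    forall (n : nat) (p xi : nat -> R), p 0%N = a -> p n = b ->
      (forall i, (i < n)%N ->
        p i <= xi i <= p i.+1 /\ p i.+1 - p i < delta) ->
      `|\sum_(i < n) f (xi i) * (g (p i.+1) - g (p i)) - l| < eps.

(* The value is arbitrary when no Riemann-Stieltjes integral exists. *)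
Definition RS_integral (f g : R -> R) (a b : R) : R :=
  get (is_RS_integral f g a b).

(* sig_rev takes the letters in the order i_k, ..., i_1 and integrates along
   the first one outermost: the variable u_k of the simplex
   0 < u_1 < ... < u_k < t is the outermost one. *)
Fixpoint sig_rev (n : nat) (Y : R -> 'rV[R]_n) (J : seq 'I_n) (t : R) : R :=
  if J is i :: J' then RS_integral (sig_rev Y J') (fun u => Y u 0 i) 0 t
  else 1.

Definition signature (n : nat) (Y : R -> 'rV[R]_n) (I : seq 'I_n) (t : R) : R :=
  sig_rev Y (rev I) t.

Definition sig_linear (n N : nat) (l : seq 'I_n -> R) (Y : R -> 'rV[R]_n)
    (T : R) : R :=
  \sum_(k < N.+1) \sum_(I : k.-tuple 'I_n) l I * signature Y I T.

End Signature.

Section SignatureSpan.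
Context {R : realType} (T alpha' : R) (d : nat) (x0 : 'rV[R]_d) (s : seq R).
Local Notation E := (path_space T alpha' x0 s).

(* fine is harmless: the norm is finite by holder_norm_fin. *)
Definition exp_weight (alpha beta gamma : R) (x : E) : R :=
  expR (beta * fine (holder_norm T alpha x) `^ gamma).

Definition sig_span : set (E -> R) :=
  [set F | exists (N : nat) (l : seq 'I_(1 + d) -> R),
     F = fun x : E => sig_linear N l x T].

End SignatureSpan.

Arguments sig_span {R T alpha' d x0 s}.

(* Main.v *)
Require Import Defs.
From mathcomp Require Import all_boot all_order all_algebra.
From mathcomp Require Import all_classical all_reals all_analysis.
From mathcomp Require Import ring lra.

(** The path space is finite dimensional: a path is determined by its increments
    c_(k, i) = x(t_(k+1))_i - x(t_k)_i over the cells of the partition.  The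
    proof identifies the span of the signature coordinates with the algebra of
    polynomials in these increments, and then shows that polynomials are dense
    for any weight that grows at least exponentially.

    Span of the signature = polynomials in the increments
    ([poly_fun_sig_span]).  On each cell the path is affine, so by induction on
    the word an iterated integral is, on each cell, a polynomial in time whose
    coefficients are polynomials in the increments
    ([piecewise_poly_primitive], [sig_rev_regular]).  Conversely the span is an
    algebra, by the shuffle identity ([sig_rev_shuffle]), and it contains every
    increment: if P is the polynomial that interpolates the values 0 at
    t_0, ..., t_k and t_(k+1) - t_k at t_(k+1), ..., t_n, then the integral of
    P' against x_i is the increment c_(k, i), and since time is a coordinate of
    the path this integral is a combination of the coordinates of the words
    0 ... 0 i ([word_span_increment]).

    Riemann-Stieltjes integrals are handled through a relation between
    functions: H is a [primitive] of f dg when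
    H(v) - H(u) = f(u) (g(v) - g(u)) + O((v - u)^2).  For Lipschitz f and g the
    Riemann-Stieltjes sums then converge to the increment of H
    ([primitive_RS_integralE]), so primitives are unique, and the product rule,
    on which the shuffle identity rests, is an algebraic identity modulo
    second-order terms.

    Density ([poly_fun_weighted_dense]).  Let the weight be exp w, with
    b |c_i| <= a + w for some b > 0.  Call a bounded continuous h a multiplier
    if p h is in the closure of the polynomials for every polynomial p.
    Multipliers form an algebra, and a lattice because |t| is a uniform limit of
    polynomials on [-1, 1].  They contain sin (lam c_i) for small lam > 0,
    because the N-th Taylor remainder of sin y is at most 2^(-N) exp (2 |y|),
    which the weight absorbs; hence they separate points.  By Stone-Weierstrass a
    bounded continuous g is uniformly close to a multiplier on a compact
    sublevel set of w; truncating this multiplier at the level sup |g| keeps it a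
    multiplier, and outside the sublevel set the error is dominated by the
    weight.  The exponent gamma >= 1 provides the hypothesis b |c_i| <= a + w: it
    gives beta r <= beta + beta r^gamma for the Hoelder norm r, which dominates the
    increments up to a constant.  Compactness of the sublevel sets comes from a
    continuous parametrization of the paths by their values at the nodes
    ([holder_ball_compact]). *)

Set Implicit Arguments.
Unset Strict Implicit.
Unset Printing Implicit Defensive.

Import Order.TTheory GRing.Theory Num.Theory.
Import numFieldNormedType.Exports.

Local Open Scope classical_set_scope.
Local Open Scope ring_scope.

(** * A lattice Stone-Weierstrass theorem on a compact set *)

Section LatticeStoneWeierstrass.
Context {R : realType} {E : topologicalType}.

(** A Dini argument.  The sets of members of S above a given member form a
    filter, because S is directed; the strict inequality holds near each point of
    K and for all larger members, so the near-covering form of compactness makes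
    it hold on K for a single member. *)
Lemma compact_directed_lt (K : set E) (S : set (E -> R)) (f : E -> R) :
  compact K -> S !=set0 -> (forall h, S h -> continuous h) -> continuous f ->
  (forall h1 h2, S h1 -> S h2 ->
     exists2 h, S h & forall x, h1 x <= h x /\ h2 x <= h x) ->
  (forall y, K y -> exists2 h, S h & f y < h y) ->
  exists2 h, S h & forall y, K y -> f y < h y.
Proof.
move=> /compact_near_coveringP Kc S0 Sc fc Sdir fS.
pose above h0 := [set h | S h /\ forall x, h0 x <= h x].
have FF : Filter (filter_from S above).
  apply: filter_from_filter => // h1 h2 S1 S2.
  have [h Sh h12] := Sdir _ _ S1 S2; exists h => // k [Sk hk].
  by split; split=> // x; apply: le_trans (hk x); case: (h12 x).
have := Kc _ _ (fun h y => f y < h y) FF.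
case=> [y /fS[h Sh fh]|h Sh habove].
  exists ([set z | f z < h z], above h) => /=; last first.
    by move=> [z k] /= [fz [_ hk]]; exact: lt_le_trans fz (hk z).
  split; last by exists h.
  have hf : (fun z => h z - f z) @ y --> h y - f y.
    by apply: cvgB; [exact: Sc|exact: fc].
  have : \forall z \near y, 0 < h z - f z.
    by apply: (cvgr_gt _ hf); rewrite subr_gt0.
  by apply: filterS => z /=; rewrite subr_gt0.
by exists h => // y Ky; apply: (habove h).
Qed.

(** Interpolation at two points is possible in B by separation.  Directed
    suprema, via [compact_directed_lt], turn the interpolants through a fixed point
    x into a member of B equal to g at x and above g - e on K; the opposites of
    these again form a directed family, which gives the upper bound. *)
Lemma lattice_stone_weierstrass (K : set E) (B : set (E -> R)) (g : E -> R) :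
  compact K -> (forall h, B h -> continuous h) ->
  (forall a, B (fun=> a)) ->
  (forall h1 h2, B h1 -> B h2 -> B (fun x => h1 x + h2 x)) ->
  (forall a h, B h -> B (fun x => a * h x)) ->
  (forall h1 h2, B h1 -> B h2 -> B (fun x => Num.max (h1 x) (h2 x))) ->
  (forall x y, K x -> K y -> x <> y -> exists2 h, B h & h x != h y) ->
  continuous g ->
  forall e, 0 < e -> exists2 h, B h & forall x, K x -> `|h x - g x| < e.
Proof.
move=> Kc Bc Bcst BD BZ Bmax Bsep gc e e0.
have interp x y : K x -> K y -> exists2 h, B h & h x = g x /\ h y = g y.
  move=> Kx Ky; have [->|xy] := pselect (x = y).
    by exists (fun=> g y).
  have [h Bh hxy] := Bsep _ _ Kx Ky xy.
  have hyx0 : h y - h x != 0 by rewrite subr_eq0 eq_sym.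
  exists (fun z => g x - h x * ((g y - g x) / (h y - h x))
                   + (g y - g x) / (h y - h x) * h z).
    by apply: BD => //; exact: BZ.
  by split; field.
have below x : K x -> exists2 h, B h & h x = g x /\ forall y, K y -> g y - e < h y.
  move=> Kx.
  have [||||||h [Bh hx] hg] := @compact_directed_lt K
      [set h | B h /\ h x = g x] (fun y => g y - e) => //.
  - by exists (fun=> g x).
  - by move=> h [/Bc].
  - by move=> y; apply: cvgB; [exact: gc|exact: cvg_cst].
  - move=> h1 h2 [B1 e1] [B2 e2]; exists (fun y => Num.max (h1 y) (h2 y)).
      by split; [exact: Bmax|rewrite e1 e2 maxxx].
    by move=> y; rewrite !le_max !lexx orbT.
  - move=> y Ky; have [h Bh [hx hy]] := interp _ _ Kx Ky.
    by exists h => //; rewrite hy ltrBlDr ltrDl.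
  by exists h.
have BN h : B h -> B (fun x => - h x).
  move=> /(BZ (-1)); congr B; apply/funext => x; exact: mulN1r.
have [[x Kx]|/nonemptyPn K0] := pselect (K !=set0); last first.
  by exists (fun=> 0) => // x; rewrite K0.
have [||||||h [Bh hlt] hgt] := @compact_directed_lt K
    [set h | B h /\ forall y, K y -> h y < e - g y] (fun y => - g y - e) => //.
- have [h Bh [_ hg]] := below _ Kx; exists (fun y => - h y); split; first exact: BN.
  by move=> y /hg; lra.
- by move=> h [/Bc].
- by move=> y; apply: cvgB; [apply: cvgN; exact: gc|exact: cvg_cst].
- move=> h1 h2 [B1 l1] [B2 l2]; exists (fun y => Num.max (h1 y) (h2 y)).
    by split=> [|y Ky]; [exact: Bmax|rewrite gt_max l1 ?l2].
  by move=> y; rewrite !le_max !lexx orbT.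
- move=> y Ky; have [h Bh [hy hg]] := below _ Ky; exists (fun z => - h z).
    by split; [exact: BN|move=> z /hg; lra].
  by rewrite hy; lra.
exists (fun x => - h x); first exact: BN.
by move=> y Ky; rewrite ltr_norml; have := hlt _ Ky; have := hgt _ Ky; lra.
Qed.

End LatticeStoneWeierstrass.

(** * Polynomial approximation of the absolute value and of the sine *)

Section Approximants.
Context {R : realType}.

(** The iteration p <- p + (t^2 - p^2) / 2, which increases to |t| on [-1, 1]. *)
Fixpoint abs_approx (k : nat) (t : R) : R :=
  if k is k'.+1 then
    abs_approx k' t + 2^-1 * (t * t - abs_approx k' t * abs_approx k' t)
  else 0.

(** The error e_k = |t| - p_k satisfies e_(k+1) <= e_k (1 - |t| / 2), hence
    e_k (1 + k |t| / 2) <= |t|; this gives a rate 2 / k that is uniform in t. *)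
Lemma abs_approxP k t : `|t| <= 1 ->
  [/\ 0 <= abs_approx k t, abs_approx k t <= `|t| &
      k%:R * (`|t| - abs_approx k t) <= 2].
Proof.
move=> t1; have a0 : 0 <= `|t| by [].
have tt : t * t = `|t| * `|t| by rewrite -!expr2 real_normK ?num_real.
suff [p0 pt ke] : [/\ 0 <= abs_approx k t, abs_approx k t <= `|t| &
    (`|t| - abs_approx k t) * (1 + k%:R * `|t| / 2) <= `|t|].
  split=> //; have [t0|tn0] := eqVneq `|t| 0.
    by move: p0 pt; rewrite t0 => p0 pt; rewrite (_ : abs_approx k t = 0) ?subrr ?mulr0//; lra.
  have tp : 0 < `|t| by rewrite lt_neqAle eq_sym tn0.
  rewrite -(ler_pM2r tp); have : 0 <= k%:R :> R by [].
  by move: ke pt p0; set p := abs_approx _ _; set K := k%:R; nra.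
elim: k => [|k [p0 pt ke]] /=; first by split=> //; lra.
rewrite tt; move: p0 pt ke; set p := abs_approx _ _; set a := `|t| in a0 t1 tt *.
move=> p0 pa ke; split.
- nra.
- nra.
have k0 : 0 <= k%:R :> R by [].
rewrite -[k.+1%:R]natr1; set K := k%:R in k0 ke *; apply: le_trans ke.
have -> : a - (p + 2^-1 * (a * a - p * p)) = (a - p) * (1 - (a + p) / 2) by field.
rewrite -(mulrA (a - p)) ler_wpM2l ?subr_ge0//.
have h0 : 0 <= 1 + (K + 1) * a / 2 by nra.
apply: (@le_trans _ _ ((1 - a / 2) * (1 + (K + 1) * a / 2))); last by nra.
by rewrite ler_wpM2r//; lra.
Qed.

(** The k-th Taylor term is at most |y|^k / k! = 2^(-k) (2 |y|)^k / k!, so the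
    tail from N on is at most 2^(-N) times the exponential series at 2 |y|. *)
Lemma sin_taylor_bound (y : R) N :
  `|sin y - series (sin_coeff y) N| <= 2 ^- N * expR (2 * `|y|).
Proof.
have sc : series (sin_coeff y) @ \oo --> sin y.
  by rewrite unlock; exact: is_cvg_series_sin_coeff.
have dc : (fun M => `|series (sin_coeff y) M - series (sin_coeff y) N|) @ \oo
    --> `|sin y - series (sin_coeff y) N|.
  by apply: cvg_norm; apply: cvgB => //; exact: cvg_cst.
have y0 : 0 <= 2 * `|y| by rewrite mulr_ge0.
rewrite -(cvg_lim _ dc)//; apply: limr_le; first by apply/cvg_ex; eexists; exact: dc.
exists N => // M /= NM; rewrite sub_series_geq//.
apply: le_trans (ler_norm_sum _ _ _) _.
apply: (@le_trans _ _ (\sum_(N <= k < M) 2 ^- N * exp_coeff (2 * `|y|) k)).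
  rewrite big_nat [leRHS]big_nat; apply: ler_sum => k /andP[Nk _].
  rewrite /sin_coeff /exp_coeff /= exprMn !normrM normfV !normr_nat normrX normrN1.
  rewrite expr1n mulr1 normrX mulrA ler_wpM2r ?invr_ge0//.
  rewrite mulrA ler_wpM2r ?exprn_ge0//; apply: (@le_trans _ _ 1).
    by case: odd.
  rewrite mulrC ler_pdivlMr ?exprn_gt0// mul1r.
  by rewrite ler_eXn2l// ltr1n.
rewrite -mulr_sumr ler_wpM2l ?invr_ge0 ?exprn_ge0//.
apply: (@le_trans _ _ (series (exp_coeff (2 * `|y|)) M)).
  by rewrite /series/= (big_cat_nat (m := 0%N) (n := N) (p := M))//= lerDr sumr_ge0// => k _; exact: exp_coeff_ge0.
apply: nondecreasing_cvgn_le; last exact: is_cvg_series_exp_coeff.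
by apply: nondecreasing_series => k _ _; exact: exp_coeff_ge0.
Qed.

End Approximants.

(** * Polynomials in a family of functions *)

Section GeneratedPolynomials.
Context {R : realType} {E I : Type} (c : I -> E -> R).

Inductive poly_fun : (E -> R) -> Prop :=
| poly_fun_cst a : poly_fun (fun=> a)
| poly_fun_gen i : poly_fun (c i)
| poly_funD p q : poly_fun p -> poly_fun q -> poly_fun (fun x => p x + q x)
| poly_funM p q : poly_fun p -> poly_fun q -> poly_fun (fun x => p x * q x).

Lemma poly_funZ a p : poly_fun p -> poly_fun (fun x => a * p x).
Proof. by move=> pp; apply: poly_funM => //; exact: poly_fun_cst. Qed.

Lemma poly_funB p q : poly_fun p -> poly_fun q -> poly_fun (fun x => p x - q x).
Proof.
move=> pp pq; rewrite (_ : (fun _ => _) = fun x => p x + (-1) * q x).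
  by apply: poly_funD => //; exact: poly_funZ.
by apply/funext => x; rewrite mulN1r.
Qed.

Lemma poly_fun_sum (J : Type) (r : seq J) (P : pred J) (F : J -> E -> R) :
  (forall j, P j -> poly_fun (F j)) ->
  poly_fun (fun x => \sum_(j <- r | P j) F j x).
Proof.
move=> pF; elim: r => [|j r IH].
  rewrite (_ : (fun _ => _) = fun=> 0); first exact: poly_fun_cst.
  by apply/funext => x; rewrite big_nil.
case Pj : (P j); last first.
  by under eq_fun do rewrite big_cons Pj; exact: IH.
by under eq_fun do rewrite big_cons Pj; apply: poly_funD => //; exact: pF.
Qed.

Lemma poly_funX p n : poly_fun p -> poly_fun (fun x => p x ^+ n).
Proof.
move=> pp; elim: n => [|n IH]; first exact: poly_fun_cst.
by under eq_fun do rewrite exprS; exact: poly_funM.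
Qed.

End GeneratedPolynomials.

(** * Weighted density of polynomials *)

Lemma ler_normD_half {R : realFieldType} (a b e X : R) :
  `|a| <= e / 2 * X -> `|b| <= e / 2 * X -> `|a + b| <= e * X.
Proof.
by move=> ha hb; rewrite (splitr e) mulrDl (le_trans (ler_normD _ _))// lerD.
Qed.

Section ExponentialWeight.
Context {R : realType} {E : topologicalType} {I : Type}.
Variables (c : I -> E -> R) (w : E -> R).
Hypothesis c_cont : forall i, continuous (c i).
Hypothesis w_ge0 : forall x, 0 <= w x.
Hypothesis c_le_w : forall i, exists b a, 0 < b /\ forall x, b * `|c i x| <= a + w x.

Lemma poly_fun_continuous p : poly_fun c p -> continuous p.
Proof.
elim=> [a|i|{}p q _ pc _ qc|{}p q _ pc _ qc] //.
- by move=> x; exact: cvg_cst.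
- by move=> x; apply: cvgD; [exact: pc|exact: qc].
- by move=> x; apply: cvgM; [exact: pc|exact: qc].
Qed.

(** Polynomials are dominated by every positive power of the weight; for a
    product, each factor receives half of the exponent. *)
Lemma poly_fun_growth p : poly_fun c p -> forall th : R, 0 < th ->
  exists2 C, 0 <= C & forall x, `|p x| <= C * expR (th * w x).
Proof.
elim=> [a|i|{}p q _ pc _ qc|{}p q _ pc _ qc] th th0.
- exists `|a| => // x; rewrite ler_peMr// -expR0 ler_expR.
  by rewrite mulr_ge0 ?(ltW th0).
- have [b [a [b0 Hb]]] := c_le_w i.
  exists (expR (th * a) / (th * b)).
    by rewrite divr_ge0 ?expR_ge0// mulr_ge0 ?ltW.
  move=> x; rewrite mulrAC ler_pdivlMr ?mulr_gt0// -expRD.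
  apply: (@le_trans _ _ (th * a + th * w x)).
    by rewrite mulrC -mulrA -mulrDr ler_wpM2l ?(ltW th0).
  by apply: le_trans (expR_ge1Dx _); rewrite lerDr.
- have [C C0 HC] := pc _ th0; have [D D0 HD] := qc _ th0.
  exists (C + D); first exact: addr_ge0.
  by move=> x; rewrite mulrDl (le_trans (ler_normD _ _))// lerD.
- have t20 : 0 < th / 2 by lra.
  have [C C0 HC] := pc _ t20; have [D D0 HD] := qc _ t20.
  exists (C * D); first exact: mulr_ge0.
  move=> x; rewrite {1}(splitr th) mulrDl expRD mulrACA normrM.
  exact: ler_pM.
Qed.

Definition approximable (f : E -> R) := forall e : R, 0 < e ->
  exists2 p, poly_fun c p & forall x, `|f x - p x| <= e * expR (w x).

(** Multiplying by all polynomials, and not only by constants, is what makes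
    these functions an algebra: the closure of the polynomials for the weight is
    not stable under products. *)
Definition multiplier (h : E -> R) := [/\ continuous h,
  exists2 M, 0 < M & forall x, `|h x| <= M &
  forall p, poly_fun c p -> approximable (fun x => p x * h x)].

Lemma multiplier_cst a : multiplier (fun=> a).
Proof.
split; first by move=> x; exact: cvg_cst.
  by exists (`|a| + 1) => [|x]; [rewrite ltr_wpDl|rewrite lerDl].
move=> p pp e e0; exists (fun x => p x * a).
  by apply: poly_funM => //; exact: poly_fun_cst.
by move=> x; rewrite subrr normr0 mulr_ge0 ?(ltW e0) ?expR_ge0.
Qed.

Lemma multiplierD h1 h2 : multiplier h1 -> multiplier h2 ->
  multiplier (fun x => h1 x + h2 x).
Proof.
move=> [c1 [M1 M10 H1] A1] [c2 [M2 M20 H2] A2]; split.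
- by move=> x; apply: cvgD; [exact: c1|exact: c2].
- exists (M1 + M2); first exact: addr_gt0.
  by move=> x; rewrite (le_trans (ler_normD _ _))// lerD.
- move=> p pp e e0; have e20 : 0 < e / 2 by lra.
  have [q1 pq1 Hq1] := A1 _ pp _ e20; have [q2 pq2 Hq2] := A2 _ pp _ e20.
  exists (fun x => q1 x + q2 x); first exact: poly_funD.
  by move=> x; rewrite mulrDr opprD addrACA; exact: ler_normD_half.
Qed.

(** p h1 is close to a polynomial q, and then q h2 is close to a polynomial;
    the boundedness of h2 keeps the first error under control. *)
Lemma multiplierM h1 h2 : multiplier h1 -> multiplier h2 ->
  multiplier (fun x => h1 x * h2 x).
Proof.
move=> [c1 [M1 M10 H1] A1] [c2 [M2 M20 H2] A2]; split.
- by move=> x; apply: cvgM; [exact: c1|exact: c2].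
- exists (M1 * M2); first exact: mulr_gt0.
  by move=> x; rewrite normrM ler_pM.
- move=> p pp e e0; have e20 : 0 < e / 2 by lra.
  have [q pq Hq] := A1 _ pp _ (divr_gt0 e20 M20).
  have [r pr Hr] := A2 _ pq _ e20; exists r => // x.
  rewrite (_ : _ - _ = (p x * h1 x - q x) * h2 x + (q x * h2 x - r x)); last by ring.
  apply: ler_normD_half => //; rewrite normrM.
  apply: (@le_trans _ _ (e / 2 / M2 * expR (w x) * M2)); first exact: ler_pM.
  by rewrite mulrAC divfK ?gt_eqF.
Qed.

Lemma multiplierZ a h : multiplier h -> multiplier (fun x => a * h x).
Proof. by move=> mh; apply: multiplierM => //; exact: multiplier_cst. Qed.

(** After scaling h into [-1, 1], the functions [abs_approx] applied to h are
    multipliers converging uniformly to |h|, and p is bounded relatively to the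
    weight. *)
Lemma multiplier_abs h : multiplier h -> multiplier (fun x => `|h x|).
Proof.
move=> mh; have [hc [M M0 HM] hA] := mh; split.
- by move=> x; apply: cvg_norm; exact: hc.
- by exists M => // x; rewrite normr_id.
pose t x := M^-1 * h x.
have t1 x : `|t x| <= 1.
  by rewrite /t normrM normfV (gtr0_norm M0) mulrC ler_pdivrMr// mul1r.
have mt k : multiplier (fun x => abs_approx k (t x)).
  elim: k => [|k IH] /=; first exact: multiplier_cst.
  apply: multiplierD => //; apply: multiplierZ; apply: multiplierD.
    by apply: multiplierM; exact: multiplierZ.
  rewrite (_ : (fun _ => _) = fun x => -1 * (abs_approx k (t x) * abs_approx k (t x))).
    by apply: multiplierZ; exact: multiplierM.
  by apply/funext => x; rewrite mulN1r.
move=> p pp e e0; have [C C0 HC] := poly_fun_growth pp ltr01.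
have e20 : 0 < e / 2 by lra.
(* k is such that the error 2 C M / k of the k-th iterate, weighted by p, is at
   most e / 2. *)
pose k := (Num.truncn (4 * M * C / e)).+1.
have kC : 4 * M * C <= k%:R * e.
  by rewrite -ler_pdivrMr//; apply: ltW; exact: truncnS_gt.
have [_ _ A] := multiplierZ M (mt k).
have [q pq Hq] := A _ pp _ e20; exists q => // x.
have Mt : `|h x| = M * `|t x|.
  by rewrite /t normrM normfV (gtr0_norm M0) mulrA divff ?mul1r// gt_eqF.
rewrite (_ : _ - _ = p x * (M * (`|t x| - abs_approx k (t x)))
   + (p x * (M * abs_approx k (t x)) - q x)); last by rewrite Mt; ring.
apply: ler_normD_half => //.
have [a0 a1 ka] := abs_approxP k (t1 x).
have d0 : 0 <= `|t x| - abs_approx k (t x) by rewrite subr_ge0.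
rewrite normrM [in leLHS]normrM (gtr0_norm M0) (ger0_norm d0).
have k0 : 0 < k%:R :> R by rewrite ltr0n.
have := HC x; rewrite mul1r.
move: (`|p x|) (normr_ge0 (p x)) (expR (w x)) (expR_ge0 (w x)) d0 ka => P P0 X X0.
set d := `|t x| - _ => d0 ka PC.
apply: (@le_trans _ _ (C * X * (M * d))); first by rewrite ler_wpM2r// mulr_ge0// ltW.
rewrite (_ : C * X * (M * d) = C * M * d * X); last by ring.
rewrite ler_wpM2r// -(ler_pM2l k0).
have CM0 : 0 <= C * M by rewrite mulr_ge0// ltW.
nra.
Qed.

Lemma multiplier_max h1 h2 : multiplier h1 -> multiplier h2 ->
  multiplier (fun x => Num.max (h1 x) (h2 x)).
Proof.
move=> m1 m2; under eq_fun do rewrite maxr_absE mulrC.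
apply: multiplierZ; apply: multiplierD; first exact: multiplierD.
apply: multiplier_abs; apply: multiplierD => //.
rewrite (_ : (fun _ => _) = fun x => -1 * h2 x); first exact: multiplierZ.
by apply/funext => x; rewrite mulN1r.
Qed.

(** With lam <= b / 4 the Taylor error of [sin_taylor_bound] grows at most like
    exp (w / 2), which leaves the other half of the exponent for the polynomial p. *)
Lemma multiplier_sin i : exists2 lam0, 0 < lam0 &
  forall lam, 0 <= lam <= lam0 -> multiplier (fun x => sin (lam * c i x)).
Proof.
have [b [a [b0 Hb]]] := c_le_w i; exists (b / 4); first by lra.
move=> lam /andP[l0 lb]; split.
- move=> x; apply: (@continuous_comp _ _ _ (fun x => lam * c i x) sin).
    by apply: cvgM; [exact: cvg_cst|exact: c_cont].
  exact: continuous_sin.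
- by exists 1 => // x; rewrite ler_norml sin_geN1 sin_le1.
move=> p pp e e0; have h0 : 0 < 2^-1 :> R by lra.
have [C C0 HC] := poly_fun_growth pp h0.
pose D := C * expR (a / 2).
have D0 : 0 <= D by rewrite mulr_ge0 ?expR_ge0.
(* 2^N >= N + 1 > D / e. *)
pose N := Num.truncn (D / e).
have ND : D <= e * 2 ^+ N.
  rewrite mulrC -ler_pdivrMr//; apply: (@le_trans _ _ N.+1%:R).
    by apply: ltW; exact: truncnS_gt.
  by rewrite -natrX ler_nat ltn_expl.
exists (fun x => p x * series (sin_coeff (lam * c i x)) N).
  apply: poly_funM => //; apply: poly_fun_sum => k _.
  rewrite /sin_coeff /=; under eq_fun do rewrite mulrAC exprMn.
  apply: poly_funM; last by apply: poly_funM; [exact: poly_fun_cst|apply: poly_funX; exact: poly_fun_gen].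
  exact: poly_fun_cst.
move=> x; rewrite -mulrBr normrM.
apply: (@le_trans _ _ (C * expR (2^-1 * w x) * (2 ^- N * expR ((a + w x) / 2)))).
  apply: ler_pM => //; apply: le_trans (sin_taylor_bound _ _) _.
  rewrite ler_wpM2l ?invr_ge0 ?exprn_ge0// ler_expR normrM (ger0_norm l0).
  by have := Hb x; have := normr_ge0 (c i x); nra.
rewrite (_ : C * _ * _ = D * (2 ^- N) * expR (w x)).
  rewrite ler_wpM2r ?expR_ge0// ler_pdivrMr ?exprn_gt0//.
rewrite /D [in X in _ = _ * X](_ : w x = 2^-1 * w x + w x / 2); last by lra.
by rewrite mulrDl !expRD; ring.
Qed.

Hypothesis w_compact : forall r, exists2 K, compact K & forall x, ~ K x -> r <= w x.
Hypothesis c_sep : forall x y, x <> y -> exists i, c i x != c i y.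

(** For lam small enough, depending on the two points, lam c_i takes values in
    [-1, 1] at both of them, where sin is injective. *)
Lemma multiplier_sep x y : x <> y -> exists2 h, multiplier h & h x != h y.
Proof.
move=> /c_sep[i cxy]; have [l0 l00 Hl] := multiplier_sin i.
pose m := 1 + `|c i x| + `|c i y|.
have m0 : 0 < m by rewrite /m -addrA ltr_pwDl// addr_ge0.
pose lam := Num.min l0 m^-1.
have lp : 0 < lam by rewrite lt_min l00 invr_gt0.
exists (fun z => sin (lam * c i z)).
  by apply: Hl; rewrite (ltW lp) ge_min lexx.
apply: contra cxy => /eqP sxy.
have dom z : `|c i z| <= m -> lam * c i z \in `[- (pi / 2), pi / 2].
  move=> zm; rewrite in_itv /= -ler_norml (@le_trans _ _ 1)//; last first.
    by rewrite ler_pdivlMr// mul1r pi_ge2.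
  rewrite normrM (gtr0_norm lp) (@le_trans _ _ (m^-1 * m))//.
    by rewrite ler_pM ?(ltW lp)// ge_min lexx orbT.
  by rewrite mulVf ?gt_eqF.
have /(mulfI (lt0r_neq0 lp))/eqP// : lam * c i x = lam * c i y.
apply: (sin_inj _ _ sxy); apply: dom; rewrite /m.
  by have := normr_ge0 (c i y); lra.
by have := normr_ge0 (c i x); lra.
Qed.

Lemma bounded_continuous_approximable g : bounded_continuous g -> approximable g.
Proof.
move=> [gc [M0 HM0]] e e0.
pose M := `|M0| + 1; have Mp : 0 < M by rewrite ltr_wpDl.
have HM x : `|g x| <= M.
  by rewrite (le_trans (HM0 x))// (le_trans (ler_norm _))// lerDl.
have e20 : 0 < e / 2 by lra.
(* Outside K the bound 2 M on the error is at most (e / 2) w, hence at most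
   (e / 2) exp w. *)
have [K Kc HK] := w_compact (2 * M / (e / 2)).
have [h mh Hh] := @lattice_stone_weierstrass _ _ _ multiplier g Kc
  (fun h '(And3 hc _ _) => hc) multiplier_cst multiplierD multiplierZ
  multiplier_max (fun x y _ _ => @multiplier_sep x y) gc _ e20.
(* Truncating h at the level M leaves it close to g on K and makes it bounded
   by M outside K, where the weight is large. *)
pose k x := Num.max (- M) (-1 * Num.max (- M) (-1 * h x)).
have mk : multiplier k.
  apply: multiplier_max; first exact: multiplier_cst.
  apply: multiplierZ; apply: multiplier_max; first exact: multiplier_cst.
  exact: multiplierZ.
have kM x : `|k x| <= M.
  rewrite ler_norml /k !mulN1r le_max lexx /= ge_max (_ : - M <= M) /=; last by lra.
  by rewrite lerNl le_max lexx.
have kg x : K x -> `|k x - g x| <= e / 2.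
  move=> /Hh; have := HM x; rewrite !ler_norml ltr_norml => /andP[? ?] /andP[? ?].
  rewrite /k !mulN1r; case: (leP (- M) (- h x)) => ?.
    by case: (leP (- M) (- - h x)) => ?; apply/andP; split; lra.
  by case: (leP (- M) (- - M)) => ?; apply/andP; split; lra.
have [_ _ /(_ _ (poly_fun_cst c 1) _ e20)[p pp Hp]] := mk.
exists p => // x.
rewrite (_ : g x - p x = (g x - k x) + (1 * k x - p x)); last by ring.
apply: ler_normD_half => //; rewrite distrC.
have [/kg Kx|Kx] := pselect (K x).
  rewrite (le_trans Kx)// ler_peMr ?(ltW e20)// -expR0 ler_expR//.
rewrite (le_trans (ler_normB _ _))// (@le_trans _ _ (2 * M))//.
  by have := kM x; have := HM x; lra.
rewrite [leRHS]mulrC -ler_pdivrMr// (le_trans (HK _ Kx))//.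
by apply: le_trans (expR_ge1Dx _); rewrite lerDr.
Qed.

Lemma weighted_norm_le (f : E -> R) e :
  (forall x, `|f x| <= e * expR (w x)) ->
  (weighted_norm (expR \o w) f <= e%:E)%E.
Proof.
move=> fe; apply: ge_ereal_sup => _ [x _ <-]; rewrite lee_fin.
by rewrite ler_pdivrMr ?expR_gt0.
Qed.

Lemma weighted_norm_ltW (f : E -> R) e :
  (weighted_norm (expR \o w) f < e%:E)%E -> forall x, `|f x| <= e * expR (w x).
Proof.
move=> fe x; rewrite -ler_pdivrMr ?expR_gt0// -lee_fin; apply: ltW.
by apply: le_lt_trans fe; apply: ereal_sup_ubound; exists x.
Qed.

(** Polynomials are approximated by their truncations: where |p| > M the error
    is at most |p| <= p^2 / M, and p^2 is bounded relatively to the weight. *)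
Lemma poly_fun_weighted_space p :
  poly_fun c p -> weighted_space (expR \o w) p.
Proof.
move=> pp; split.
  have [C _ HC] := poly_fun_growth pp ltr01.
  apply: (@le_lt_trans _ _ C%:E); last exact: ltry.
  by apply: weighted_norm_le => x; have := HC x; rewrite mul1r.
move=> e e0; have [C C0 HC] := poly_fun_growth (poly_funM pp pp) ltr01.
(* p^2 <= C exp w, and C / M is smaller than e / 2. *)
pose M := 2 * C / e + 1.
have M0 : 0 < M by rewrite ltr_wpDl// divr_ge0 ?(ltW e0)// mulr_ge0.
exists (fun x => Num.max (- M) (Num.min M (p x))).
  split.
    have pc := poly_fun_continuous pp.
    have cM (a : R^o) : continuous (fun _ : E => a) by move=> x; exact: cst_continuous.
    by move=> x; exact: (continuous_max (cM _ x) (continuous_min (cM M x) (pc x))).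
  exists M => x; rewrite ler_norml le_max lexx /= ge_max (_ : - M <= M) /=; last by lra.
  by rewrite ge_min lexx.
apply: (@le_lt_trans _ _ (e / 2)%:E); last by rewrite lte_fin; lra.
apply: weighted_norm_le => x.
apply: (@le_trans _ _ (p x * p x / M)).
  rewrite ler_pdivlMr//; case: (leP M (p x)) => pM.
    by rewrite max_r ?ger0_norm; nra.
  have [pN|pN] := leP (- M) (p x); first by rewrite subrr normr0 mul0r; nra.
  by rewrite ler0_norm; nra.
rewrite ler_pdivrMr//; have := HC x; rewrite mul1r => /ler_normlW/le_trans; apply.
rewrite mulrAC ler_wpM2r ?expR_ge0// -[leLHS](divfK (lt0r_neq0 e0)) /M.
have q0 : 0 <= C / e by rewrite divr_ge0 ?(ltW e0).
by move: q0; rewrite -mulrA; set q := C / e; nra.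
Qed.

Theorem poly_fun_weighted_dense : weighted_dense E (expR \o w) (poly_fun c).
Proof.
split; first exact: poly_fun_weighted_space.
move=> f [_ fa] e e0; have e40 : 0 < e / 4 by lra.
have [g gb fg] := fa _ e40.
have [p pp gp] := bounded_continuous_approximable gb e40.
exists p => //; apply: (@le_lt_trans _ _ (e / 2)%:E); last by rewrite lte_fin; lra.
apply: weighted_norm_le => x.
rewrite (_ : f x - p x = (f x - g x) + (g x - p x)); last by ring.
rewrite (le_trans (ler_normD _ _))//.
rewrite (_ : e / 2 * _ = e / 4 * expR (w x) + e / 4 * expR (w x)); last by field.
by rewrite lerD// (weighted_norm_ltW fg).
Qed.

End ExponentialWeight.

(** * Increments up to second order and Riemann-Stieltjes integrals *)

Section IncrementCalculus.
Context {R : realType} (T : R).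
Hypothesis T_ge0 : 0 <= T.

Definition lipschitz_upto (f : R -> R) := exists2 L, 0 <= L &
  forall u v, 0 <= u -> u <= v -> v <= T -> `|f v - f u| <= L * (v - u).

Definition second_order (D : R -> R -> R) := exists2 C, 0 <= C &
  forall u v, 0 <= u -> u <= v -> v <= T -> `|D u v| <= C * (v - u) ^+ 2.

(** This encodes dH = f dg on [0, T].  The error O((v - u)^2) is summable to 0
    along fine partitions and is stable under the product rule. *)
Definition primitive (f g H : R -> R) :=
  second_order (fun u v => H v - H u - f u * (g v - g u)).

Lemma lipschitz_upto_ext f g : (forall u, 0 <= u <= T -> f u = g u) ->
  lipschitz_upto f -> lipschitz_upto g.
Proof.
move=> fg [L L0 HL]; exists L => // u v u0 uv vT.
by rewrite -!fg ?HL ?u0 ?vT ?(le_trans u0)// (le_trans uv).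
Qed.

Lemma lipschitz_upto_bounded f : lipschitz_upto f ->
  exists2 M, 0 <= M & forall u, 0 <= u -> u <= T -> `|f u| <= M.
Proof.
move=> [L L0 HL]; exists (`|f 0| + L * T); first by rewrite addr_ge0// mulr_ge0.
move=> u u0 uT; rewrite -[f u](subrK (f 0)) addrC.
rewrite (le_trans (ler_normD _ _))// lerD2l (le_trans (HL _ _ _ u0 uT))//.
by rewrite subr0 ler_wpM2l.
Qed.

Lemma second_order_ext D D' :
  (forall u v, 0 <= u -> u <= v -> v <= T -> D u v = D' u v) ->
  second_order D -> second_order D'.
Proof. by move=> DD [C C0 HC]; exists C => // u v *; rewrite -DD ?HC. Qed.

Lemma second_orderD D1 D2 : second_order D1 -> second_order D2 ->
  second_order (fun u v => D1 u v + D2 u v).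
Proof.
move=> [C C0 HC] [D D0 HD]; exists (C + D); first exact: addr_ge0.
by move=> u v u0 uv vT; rewrite mulrDl (le_trans (ler_normD _ _))// lerD ?HC ?HD.
Qed.

Lemma second_orderM f D : lipschitz_upto f -> second_order D ->
  second_order (fun u v => f u * D u v).
Proof.
move=> /lipschitz_upto_bounded[M M0 HM] [C C0 HC]; exists (M * C); first exact: mulr_ge0.
move=> u v u0 uv vT; rewrite normrM -mulrA ler_pM ?HC// HM// (le_trans uv)//.
Qed.

Lemma lipschitz_upto_cst a : lipschitz_upto (fun=> a).
Proof. by exists 0 => // u v _ _ _; rewrite subrr normr0 mul0r. Qed.

Lemma lipschitz_upto_id : lipschitz_upto id.
Proof. by exists 1 => // u v _ uv _; rewrite mul1r ger0_norm ?subr_ge0. Qed.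

Lemma second_orderZ a D : second_order D -> second_order (fun u v => a * D u v).
Proof. by apply: second_orderM; exact: lipschitz_upto_cst. Qed.

Lemma second_order_sum (J : Type) (r : seq J) (D : J -> R -> R -> R) :
  (forall j, second_order (D j)) ->
  second_order (fun u v => \sum_(j <- r) D j u v).
Proof.
move=> HD; elim: r => [|j r IH].
  by exists 0 => // u v _ _ _; rewrite big_nil normr0 mul0r.
by apply: second_order_ext (second_orderD (HD j) IH) => u v _ _ _; rewrite big_cons.
Qed.

Lemma second_order_lipschitzM f g : lipschitz_upto f -> lipschitz_upto g ->
  second_order (fun u v => (f v - f u) * (g v - g u)).
Proof.
move=> [L L0 HL] [M M0 HM]; exists (L * M); first exact: mulr_ge0.
move=> u v u0 uv vT; rewrite normrM expr2 mulrACA.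
by rewrite ler_pM ?HL ?HM.
Qed.

Lemma primitive_sum (J : Type) (r : seq J) (a : J -> R) (f H : J -> R -> R) g :
  (forall j, primitive (f j) g (H j)) ->
  primitive (fun u => \sum_(j <- r) a j * f j u) g
            (fun u => \sum_(j <- r) a j * H j u).
Proof.
move=> fH; apply: (second_order_ext (D := fun u v => \sum_(j <- r)
    a j * (H j v - H j u - f j u * (g v - g u)))); last first.
  by apply: second_order_sum => j; exact: (second_orderZ (a j) (fH j)).
move=> u v _ _ _; rewrite mulr_suml -!sumrB.
by apply: eq_bigr => j _; ring.
Qed.

Lemma primitive_ext f1 f2 g H1 H2 :
  (forall u, 0 <= u <= T -> f1 u = f2 u) ->
  (forall u, 0 <= u <= T -> H1 u = H2 u) ->
  primitive f1 g H1 -> primitive f2 g H2.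
Proof.
move=> f12 H12; apply: second_order_ext => u v u0 uv vT.
by rewrite f12 ?H12 ?u0 ?vT ?(le_trans u0)// (le_trans uv).
Qed.

Lemma primitive_lipschitz f g H :
  lipschitz_upto f -> lipschitz_upto g -> primitive f g H -> lipschitz_upto H.
Proof.
move=> /lipschitz_upto_bounded[M M0 HM] [L L0 HL] [C C0 HC].
exists (M * L + C * T) => [|u v u0 uv vT]; first by rewrite addr_ge0 ?mulr_ge0.
rewrite -[H v - H u](subrK (f u * (g v - g u))) addrC.
rewrite (le_trans (ler_normD _ _))// mulrDl lerD//.
  by rewrite normrM -mulrA ler_pM ?HL ?HM// (le_trans uv).
rewrite (le_trans (HC _ _ u0 uv vT))// expr2 mulrA ler_wpM2r ?subr_ge0//.
by rewrite ler_wpM2l// lerBlDr (le_trans vT)// lerDl.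
Qed.

(** Regular subdivisions of [0, t] provide partitions of arbitrarily small mesh,
    to which both limits apply. *)
Lemma is_RS_integral_unique (f g : R -> R) t l1 l2 : 0 <= t ->
  is_RS_integral f g 0 t l1 -> is_RS_integral f g 0 t l2 -> l1 = l2.
Proof.
move=> t0 h1 h2; apply/eqP; rewrite -subr_eq0 -normr_le0; apply/ler_addgt0Pl => e e0.
rewrite addr0; have e20 : 0 < e / 2 by lra.
have [d1 d10 H1] := h1 _ e20; have [d2 d20 H2] := h2 _ e20.
pose d := Num.min d1 d2; have d0 : 0 < d by rewrite lt_min d10.
pose n := (Num.truncn (t / d)).+1.
have n0 : 0 < n%:R :> R by rewrite ltr0n.
have tn : t / n%:R < d.
  by rewrite ltr_pdivrMr// mulrC -ltr_pdivrMr//; exact: truncnS_gt.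
pose p i : R := t / n%:R * i%:R.
have dp i : p i.+1 - p i = t / n%:R by rewrite /p -natr1 mulrDr mulr1 addrAC subrr add0r.
have pn : p n = t by rewrite /p divfK ?gt_eqF.
have p0 : p 0%N = 0 by rewrite /p mulr0.
have pp i : p i <= p i <= p i.+1.
  by rewrite lexx -subr_ge0 dp divr_ge0.
have dd i : p i.+1 - p i < d1 /\ p i.+1 - p i < d2.
  by rewrite dp; move: tn; rewrite lt_min => /andP[].
have := H1 n p p p0 pn (fun i _ => conj (pp i) (dd i).1).
have := H2 n p p p0 pn (fun i _ => conj (pp i) (dd i).2).
by rewrite !ltr_norml ler_norml => /andP[? ?] /andP[? ?]; apply/andP; split; lra.
Qed.

(** On a step of length h, replacing the tag by the left end point costs
    O(h^2) since f and g are Lipschitz; the total error over a partition of mesh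
    delta is then O(delta t). *)
Lemma primitive_is_RS f g H t : lipschitz_upto f -> lipschitz_upto g -> primitive f g H ->
  0 <= t <= T -> is_RS_integral f g 0 t (H t - H 0).
Proof.
move=> [L L0 HL] [M M0 HM] [C C0 HC] /andP[t0 tT] e e0.
pose A := C + L * M; have A0 : 0 <= A by rewrite addr_ge0 ?mulr_ge0.
have At : 0 < A * t + 1 by rewrite ltr_wpDl ?mulr_ge0.
exists (e / (A * t + 1)); first exact: divr_gt0.
set del := e / _; move=> n p xi p0 pn Hp.
have del0 : 0 < del by exact: divr_gt0.
have step i : (i < n)%N -> p i <= p i.+1.
  by move=> /Hp[/andP[h1 h2] _]; exact: le_trans h1 h2.
have pge0 i : (i <= n)%N -> 0 <= p i.
  by elim: i => [|i IH] ilt; [rewrite p0|apply: le_trans (step _ ilt); apply: IH; exact: ltnW].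
have plet i : (i <= n)%N -> p (n - i)%N <= t.
  elim: i => [|i IH] ilt; first by rewrite subn0 pn.
  apply: le_trans (IH (ltnW ilt)); rewrite subnS.
  by rewrite -[in leRHS](prednK (_ : 0 < n - i)%N) ?subn_gt0// step// prednK ?subn_gt0// leq_subr.
have plet' i : (i <= n)%N -> p i <= t.
  by move=> ilt; rewrite -(subKn ilt) plet// leq_subr.
have -> : H t - H 0 = \sum_(i < n) (H (p i.+1) - H (p i)).
  by rewrite -(big_mkord xpredT (fun i => H (p i.+1) - H (p i))) telescope_sumr// p0 pn.
rewrite -sumrB (le_lt_trans (ler_norm_sum _ _ _))//.
apply: (@le_lt_trans _ _ (\sum_(i < n) A * del * (p i.+1 - p i))); last first.
  rewrite -mulr_sumr -(big_mkord xpredT (fun i => p i.+1 - p i)) telescope_sumr//.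
  rewrite p0 pn subr0 /del mulrAC mulrA ltr_pdivrMr// mulrC ltr_pM2l//.
  by rewrite ltrDl.
apply: ler_sum => -[i ilt] _ /=; have [/andP[h1 h2] /ltW h3] := Hp _ ilt.
have u0 := pge0 _ (ltnW ilt); have vT := le_trans (plet' _ ilt) tT.
have uv := step _ ilt.
apply: (@le_trans _ _ (A * (p i.+1 - p i) ^+ 2)); last first.
  by rewrite expr2 mulrA ler_wpM2r ?subr_ge0// ler_wpM2l.
rewrite (_ : _ - _ = - (H (p i.+1) - H (p i) - f (p i) * (g (p i.+1) - g (p i)))
   + (f (xi i) - f (p i)) * (g (p i.+1) - g (p i))); last by ring.
rewrite (le_trans (ler_normD _ _))// normrN /A [leRHS]mulrDl lerD ?HC// normrM.
rewrite expr2 mulrACA ler_pM ?HM// (le_trans (HL _ _ _ _ _))// ?(le_trans h2)//.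
by rewrite ler_wpM2l// lerD2r.
Qed.

Lemma primitive_RS_integralE f g H t :
  lipschitz_upto f -> lipschitz_upto g -> primitive f g H ->
  0 <= t <= T -> RS_integral f g 0 t = H t - H 0.
Proof.
move=> fl gl fgH tT; have HRS := primitive_is_RS fl gl fgH tT.
apply: get_unique => // l; have /andP[t0 _] := tT.
by move/is_RS_integral_unique; exact.
Qed.

Lemma primitive_unique f g H K t : lipschitz_upto f -> lipschitz_upto g ->
  primitive f g H -> primitive f g K -> 0 <= t <= T -> H t - H 0 = K t - K 0.
Proof.
move=> fl gl fgH fgK tT.
by rewrite -(primitive_RS_integralE fl gl fgH tT) (primitive_RS_integralE fl gl fgK tT).
Qed.

(** Horner induction: the derivative of P X + c is P' X + P, and
    the product rule holds up to the second-order term (P v - P u) (v - u). *)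
Lemma poly_primitive (P : {poly R}) :
  lipschitz_upto (horner P) /\ primitive (horner P^`()) id (horner P).
Proof.
elim/poly_ind: P => [|P c [Pl Pp]].
  split; first by apply: lipschitz_upto_ext (lipschitz_upto_cst 0) => u _; rewrite horner0.
  by exists 0 => // u v _ _ _; rewrite deriv0 !horner0 mul0r !subr0 normr0 mul0r.
have prim : primitive (horner (P * 'X + c%:P)^`()) id (horner (P * 'X + c%:P)).
  have := second_orderD (second_orderM lipschitz_upto_id Pp)
                        (second_order_lipschitzM Pl lipschitz_upto_id).
  apply: second_order_ext => u v _ _ _ /=.
  by rewrite derivD derivC addr0 derivM derivX mulr1 !hornerE; ring.
split=> //; have [M M0 HM] := lipschitz_upto_bounded Pl; have [L L0 HL] := Pl.
exists (L * T + M) => [|u v u0 uv vT]; first by rewrite addr_ge0 ?mulr_ge0.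
rewrite !hornerE (_ : _ - _ = (P.[v] - P.[u]) * v + P.[u] * (v - u)); last by ring.
rewrite (le_trans (ler_normD _ _))// [leRHS]mulrDl !normrM lerD//.
  rewrite mulrAC ler_pM ?HL// ger0_norm// (le_trans u0)//.
by rewrite ler_pM ?HM ?(le_trans uv)// ger0_norm// subr_ge0.
Qed.

Lemma monomial_primitive j :
  primitive (fun u => u ^+ j) id (fun u => (j.+1%:R)^-1 * u ^+ j.+1).
Proof.
have [_ /(second_orderZ (j.+1%:R)^-1)] := poly_primitive 'X^(j.+1).
apply: second_order_ext => u v _ _ _.
rewrite derivXn hornerMn !hornerXn -mulr_natl /=.
by field; rewrite addrC natr1 pnatr_eq0.
Qed.

End IncrementCalculus.

Section Gluing.
Context {R : realType}.

(** Chasles-type induction over the nodes, with the property of an interval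
    left abstract. *)
Lemma path_glue (s : seq R) (a b : R) (P : R -> R -> Prop) :
  path <%O a (b :: s) ->
  (forall u m v, a <= u -> u <= m -> m <= v -> v <= last b s ->
     P u m -> P m v -> P u v) ->
  (forall k u v, (k < (size s).+1)%N -> nth 0 (a :: b :: s) k <= u -> u <= v ->
     v <= nth 0 (b :: s) k -> P u v) ->
  forall u v, a <= u -> u <= v -> v <= last b s -> P u v.
Proof.
elim: s a b => [|c s IH] a b /= /andP[ab bs] Ptrans Ppiece u v au uv vl.
  exact: (Ppiece 0%N).
have {}IH : forall u v, b <= u -> u <= v -> v <= last c s -> P u v.
  apply: IH => // [u' m v' bu|k]; last exact: (Ppiece k.+1).
  by apply: Ptrans; exact: le_trans (ltW ab) bu.
have [vb|bv] := leP v b; first exact: (Ppiece 0%N).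
have [bu|ub] := leP b u; first exact: IH.
apply: (Ptrans u b v) => //; try exact: ltW.
  by apply: (Ppiece 0%N) => //; exact: ltW.
by apply: IH => //; exact: ltW.
Qed.

Variables (T : R) (s : seq R).
Hypotheses (T_gt0 : 0 < T) (s_part : itv_partition 0 T s).
Local Notation node k := (nth 0 (0 :: s) k).

Lemma partition_glue (P : R -> R -> Prop) :
  (forall u m v, 0 <= u -> u <= m -> m <= v -> v <= T ->
     P u m -> P m v -> P u v) ->
  (forall (k : 'I_(size s)) u v, node k <= u -> u <= v -> v <= node k.+1 -> P u v) ->
  forall u v, 0 <= u -> u <= v -> v <= T -> P u v.
Proof.
have := s_part; case: s => [/itv_partition_nil T0|b s' [bs /eqP/= bT]] Ptrans Ppiece.
  by move: T_gt0; rewrite T0 ltxx.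
rewrite -bT in Ptrans *; apply: path_glue => // k u v ks ku uv.
exact: (Ppiece (Ordinal ks)).
Qed.

(** Cutting [u, v] at m changes the second-order term by
    (f m - f u) (g v - g m), which is at most L M (m - u) (v - m); a constant that
    exceeds all the local ones by L M absorbs it in the square of v - u. *)
Lemma primitive_glue (f g H : R -> R) :
  lipschitz_upto T f -> lipschitz_upto T g ->
  (forall k : 'I_(size s), exists2 C, 0 <= C & forall u v,
     node k <= u -> u <= v -> v <= node k.+1 ->
     `|H v - H u - f u * (g v - g u)| <= C * (v - u) ^+ 2) ->
  primitive T f g H.
Proof.
move=> [L L0 HL] [M M0 HM] /(_ _)/cid2-/all_sig2[C C0 HC].
pose A := \sum_k C k + L * M.
have CS k : C k <= A.
  rewrite /A (bigD1 k)//= -addrA lerDl addr_ge0 ?mulr_ge0//.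
  by apply: sumr_ge0 => j _; exact: C0.
have S0 : 0 <= \sum_k C k by apply: sumr_ge0 => j _; exact: C0.
have LM0 : 0 <= L * M by exact: mulr_ge0.
exists A; first exact: addr_ge0.
apply: partition_glue => [u m v u0 um mv vT Pum Pmv|k u v ku uv vk]; last first.
  by rewrite (le_trans (HC _ _ _ ku uv vk))// ler_wpM2r ?sqr_ge0.
rewrite (_ : _ - _ = (H m - H u - f u * (g m - g u)) +
   (H v - H m - f m * (g v - g m)) + (f m - f u) * (g v - g m)); last by ring.
rewrite (le_trans (ler_normD _ _))//.
apply: (@le_trans _ _ (A * (m - u) ^+ 2 + A * (v - m) ^+ 2
    + (L * (m - u)) * (M * (v - m)))).
  rewrite lerD//; first by rewrite (le_trans (ler_normD _ _))// lerD.
  rewrite normrM ler_pM ?HL ?HM// ?(le_trans u0)// (le_trans mv)//.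
have : 0 <= (m - u) * (v - m) by rewrite mulr_ge0 ?subr_ge0.
have -> : L * (m - u) * (M * (v - m)) = (L * M) * ((m - u) * (v - m)) by ring.
have -> : A * (v - u) ^+ 2 = A * (m - u) ^+ 2 + A * (v - m) ^+ 2
   + 2 * A * ((m - u) * (v - m)) by ring.
by move=> q0; rewrite lerD2l ler_wpM2r// /A; lra.
Qed.

End Gluing.

(** Newton's scheme: a multiple of the product of the X - b over the previous
    nodes b corrects the value at the new node. *)
Lemma poly_interpolation (F : fieldType) (ts : seq F) (y : F -> F) : uniq ts ->
  exists P : {poly F}, forall t, t \in ts -> P.[t] = y t.
Proof.
elim: ts => [_|a ts IH /= /andP[ats /IH[P HP]]]; first by exists 0.
pose W := \prod_(b <- ts) ('X - b%:P).
have Wa : W.[a] != 0.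
  by rewrite -[_ == _]/(root W a) root_prod_XsubC.
exists (P + ((y a - P.[a]) / W.[a])%:P * W) => t; rewrite inE => /orP[/eqP->|tts].
  by rewrite !hornerE divfK// addrC subrK.
rewrite !hornerE HP// (_ : W.[t] = 0) ?mulr0 ?addr0//.
by apply/eqP; rewrite -[_ == _]/(root W t) root_prod_XsubC.
Qed.

(** * Iterated integrals of piecewise linear paths *)

Section PathSignature.
Context {R : realType} {T alpha' : R} {d : nat} {x0 : 'rV[R]_d} {s : seq R}.
Hypotheses (T_gt0 : 0 < T) (s_part : itv_partition 0 T s).
Local Notation E := (path_space T alpha' x0 s).
Local Notation node k := (nth 0 (0 :: s) k).
Local Notation mesh k := (node k.+1 - node k).
Local Notation coord x i := (fun u => path_fun x u 0 i).

Let T_ge0 : 0 <= T. Proof. exact: ltW. Qed.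

Lemma node_le i j : (i <= j)%N -> (j <= size s)%N -> node i <= node j.
Proof.
have [s_path _] := s_part => ij js; have s_sorted : sorted <=%O (0 :: s).
  by apply: (sub_path _ s_path) => ? ?; exact: ltW.
apply: (sorted_leq_nth (@le_trans _ _) (@lexx _ _) 0 s_sorted) => //.
by rewrite inE /= ltnS (leq_trans ij).
Qed.

Lemma mesh_gt0 (k : 'I_(size s)) : 0 < mesh k.
Proof. by have [s_path _] := s_part; rewrite subr_gt0; apply/(pathP 0). Qed.

Lemma node_last : node (size s) = T.
Proof. by have [_ /eqP <-] := s_part; rewrite -(nth_last 0); case: (s). Qed.

Lemma node_itv (k : 'I_(size s)) u : node k <= u <= node k.+1 -> 0 <= u <= T.
Proof.
move=> /andP[ku uk]; have /andP[k0 _] := partition_node_itv s_part (ltnW (ltn_ord k)).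
have /andP[_ kT] := partition_node_itv s_part (ltn_ord k).
by rewrite (le_trans k0 ku) (le_trans uk kT).
Qed.

Definition increment (ki : 'I_(size s) * 'I_(1 + d)) (x : E) : R :=
  x (node ki.1.+1) 0 ki.2 - x (node ki.1) 0 ki.2.

Lemma path_time (x : E) u : x u 0 (lshift d ord0) = u.
Proof. by have [X _ ->] := path_funP x; rewrite row_mxEl mxE eqxx mulr1n. Qed.

Lemma path_start (x : E) : x 0 = row_mx 0 x0.
Proof.
have [X X0 ->] := path_funP x; rewrite /time_extension.
rewrite (interpolation_node (k := 0) X T_gt0 s_part)// X0; congr row_mx.
by apply/rowP => j; rewrite !mxE mul0rn.
Qed.

Lemma path_affine_from_node (x : E) (k : 'I_(size s)) i u :
  node k <= u <= node k.+1 ->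
  x u 0 i = x (node k) 0 i + increment (k, i) x / mesh k * (u - node k).
Proof.
have m0 := mesh_gt0 k; rewrite /increment; have [X _ ->] := path_funP x => ku.
case: (split_ordP i) => j ->.
  rewrite !row_mxEl (ord1 j) !mxE eqxx !mulr1n divff ?gt_eqF//; ring.
rewrite !row_mxEr (interpolationE X s_part (ltn_ord k) ku).
rewrite !(interpolation_node X T_gt0 s_part)//; last exact: ltnW.
by rewrite !mxE; ring.
Qed.

Lemma path_affine (x : E) (k : 'I_(size s)) i u v :
  node k <= u -> u <= v -> v <= node k.+1 ->
  x v 0 i - x u 0 i = increment (k, i) x / mesh k * (v - u).
Proof.
move=> ku uv vk.
have uk : node k <= u <= node k.+1 by rewrite ku (le_trans uv).
have vk' : node k <= v <= node k.+1 by rewrite vk (le_trans ku).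
by rewrite (path_affine_from_node x i uk) (path_affine_from_node x i vk'); ring.
Qed.

Lemma entry_le_enorm n (v : 'rV[R]_n) i : `|v 0 i| <= enorm v.
Proof.
rewrite -sqrtr_sqr ler_wsqrtr// (bigD1 i)//= lerDl.
by apply: sumr_ge0 => j _; exact: sqr_ge0.
Qed.

Lemma path_lipschitz (x : E) i : lipschitz_upto T (coord x i).
Proof.
have [X _ xE] := path_funP x.
have [L L0 HL] := time_extension_lipschitz X s_part.
exists L => // u v u0 uv vT; rewrite xE; apply: le_trans (HL _ _ u0 uv vT).
have := entry_le_enorm (time_extension (interpolation s X) v
   - time_extension (interpolation s X) u) i.
by rewrite mxE [X in _ + X]mxE.
Qed.

Definition clamp (k : nat) (u : R) : R := Num.max (node k) (Num.min u (node k.+1)).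

Lemma clamp_in (k : 'I_(size s)) u : node k <= u <= node k.+1 -> clamp k u = u.
Proof. by move=> /andP[ku uk]; rewrite /clamp (min_idPl uk) (max_idPr ku). Qed.

Lemma clamp_out (k l : 'I_(size s)) u v : l != k ->
  node k <= u <= node k.+1 -> node k <= v <= node k.+1 -> clamp l u = clamp l v.
Proof.
move=> lk /andP[ku uk] /andP[kv vk]; have ml : node l <= node l.+1 by exact: node_le.
have [kl|lk'] := ltnP k l.
  have le := node_le kl (ltnW (ltn_ord l)).
  have cl w : w <= node k.+1 -> clamp l w = node l.
    by move=> wk; rewrite /clamp max_l// ge_min (le_trans wk).
  by rewrite !cl.
have lek : (l < k)%N by rewrite ltn_neqAle lk.
have le := node_le lek (ltnW (ltn_ord k)).
have cl w : node k <= w -> clamp l w = node l.+1.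
  by move=> wk; rewrite /clamp (min_idPr _) ?(max_idPr _)// (le_trans le).
by rewrite !cl.
Qed.

(** Sum over the cells of slope times the increment of the local antiderivative
    Q_k.  Clamping u to the k-th cell makes the cells before u contribute fully and
    the cells after u contribute 0. *)
Definition piecewise_antiderivative (x : E) i (Q : 'I_(size s) -> R -> R) (u : R) :=
  \sum_k increment (k, i) x / mesh k * (Q k (clamp k u) - Q k (node k)).

Lemma piecewise_primitive (x : E) i (f : R -> R) (fk Q : 'I_(size s) -> R -> R) :
  lipschitz_upto T f -> (forall k, primitive T (fk k) id (Q k)) ->
  (forall (k : 'I_(size s)) u, node k <= u <= node k.+1 -> f u = fk k u) ->
  primitive T f (coord x i) (piecewise_antiderivative x i Q).
Proof.
move=> fl HQ ffk; apply: (primitive_glue T_gt0 s_part) => // [|k].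
  exact: path_lipschitz.
have [C C0 HC] := HQ k; exists (`|increment (k, i) x / mesh k| * C).
  exact: mulr_ge0.
move=> u v ku uv vk.
have uin : node k <= u <= node k.+1 by rewrite ku (le_trans uv).
have vin : node k <= v <= node k.+1 by rewrite vk (le_trans ku).
rewrite (path_affine _ _ ku uv vk) (ffk _ _ uin) /piecewise_antiderivative.
rewrite -sumrB (bigD1 k)//= big1 ?addr0; last first.
  by move=> l lk; rewrite (clamp_out lk uin vin) subrr.
rewrite !clamp_in//; move: (increment _ _ / _) => a.
rewrite (_ : _ - _ = a * (Q k v - Q k u - fk k u * (v - u))); last by ring.
have /andP[u0 _] := node_itv uin; have /andP[_ vT] := node_itv vin.
by rewrite normrM -mulrA ler_wpM2l// HC.
Qed.

(** A function of the path and of time that is a polynomial in time on each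
    cell; the degree and the coefficients, which are polynomials in the
    increments, are uniform over the paths. *)
Definition piecewise_poly (F : E -> R -> R) := forall k : 'I_(size s),
  exists m (q : nat -> E -> R), (forall j, poly_fun increment (q j)) /\
    forall x u, node k <= u <= node k.+1 -> F x u = \sum_(j < m) q j x * u ^+ j.

Lemma piecewise_poly_primitive (F : E -> R -> R) i : piecewise_poly F ->
  (forall x, lipschitz_upto T (F x)) ->
  exists2 H, piecewise_poly H &
    forall x, H x 0 = 0 /\ primitive T (F x) (coord x i) (H x).
Proof.
move=> Fpp Fl; have [m Hm] := choice Fpp; have [q Hq] := choice Hm.
pose Q k x u := \sum_(j < m k) q k j x * ((j.+1%:R)^-1 * u ^+ j.+1).
have Qpoly k u : poly_fun increment (fun x => Q k x u).
  apply: poly_fun_sum => j _; apply: poly_funM; last exact: poly_fun_cst.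
  by case: (Hq k).
pose slope k x := increment (k, i) x / mesh k.
have slope_poly k : poly_fun increment (slope k).
  by apply: poly_funM; [exact: poly_fun_gen|exact: poly_fun_cst].
exists (fun x => piecewise_antiderivative x i (Q^~ x)).
  move=> k.
  pose A x := \sum_(l | l != k) slope l x * (Q l x (clamp l (node k)) - Q l x (node l))
    - slope k x * Q k x (node k).
  exists (m k).+1, (fun j x => if j is j'.+1 then slope k x * q k j' x * (j'.+1%:R)^-1
                               else A x); split.
    case=> [|j].
      apply: poly_funB; last exact: poly_funM.
      by apply: poly_fun_sum => l _; apply: poly_funM => //; exact: poly_funB.
    apply: poly_funM; last exact: poly_fun_cst.
    by apply: poly_funM => //; case: (Hq k).
  move=> x u ku; rewrite /piecewise_antiderivative (bigD1 k)//= clamp_in//.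
  rewrite big_ord_recl expr0 mulr1 -/(slope k x).
  have -> : \sum_(l | l != k) increment (l, i) x / mesh l *
      (Q l x (clamp l u) - Q l x (node l)) =
      \sum_(l | l != k) slope l x * (Q l x (clamp l (node k)) - Q l x (node l)).
    apply: eq_bigr => l lk; rewrite (clamp_out lk ku (v := node k))//.
    by rewrite lexx node_le.
  have -> : \sum_(j < m k) slope k x * q k j x / j.+1%:R * u ^+ lift ord0 j
      = slope k x * Q k x u.
    by rewrite mulr_sumr; apply: eq_bigr => j _ /=; rewrite /bump /= add1n; ring.
  by rewrite /A; ring.
move=> x; split.
  rewrite /piecewise_antiderivative big1// => k _; rewrite (_ : clamp k 0 = node k).
    by rewrite subrr mulr0.
  have /andP[k0 _] := partition_node_itv s_part (ltnW (ltn_ord k)).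
  by rewrite /clamp max_l// ge_min k0.
apply: (@piecewise_primitive x i (F x)
  (fun k u => \sum_(j < m k) q k j x * u ^+ j) (Q^~ x)) => //.
  by move=> k; apply: primitive_sum => // j; exact: monomial_primitive.
by move=> k u ku; have [_ ->] := Hq k.
Qed.

(** Both properties have to be carried together: the Lipschitz bound makes the
    Riemann-Stieltjes integral equal to the increment of the primitive, which is
    again piecewise polynomial. *)
Lemma sig_rev_regular (J : seq 'I_(1 + d)) :
  piecewise_poly (fun x => sig_rev x J) /\ forall x : E, lipschitz_upto T (sig_rev x J).
Proof.
elim: J => [|i J [IHp IHl]].
  split=> [k|x]; last exact: lipschitz_upto_cst.
  exists 1%N, (fun _ _ => 1); split=> [j|x u _]; first exact: poly_fun_cst.
  by rewrite big_ord1 mulr1.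
have [H Hp HH] := piecewise_poly_primitive i IHp IHl.
have HE x u : 0 <= u <= T -> H x u = sig_rev x (i :: J) u.
  have [H0 HP] := HH x => uT /=.
  by rewrite (primitive_RS_integralE (IHl x) (path_lipschitz x i) HP uT) H0 subr0.
split=> [k|x].
  have [m [q [qp Hq]]] := Hp k; exists m, q; split=> // x u ku.
  by rewrite -HE ?Hq// (node_itv ku).
apply: lipschitz_upto_ext (HE x) _.
by have [_ /primitive_lipschitz] := HH x; apply => //; exact: path_lipschitz.
Qed.

Lemma sig_rev_lipschitz (x : E) J : lipschitz_upto T (sig_rev x J).
Proof. by have [_] := sig_rev_regular J. Qed.

Lemma sig_rev_primitive (x : E) i J : sig_rev x (i :: J) 0 = 0 /\
  primitive T (sig_rev x J) (coord x i) (sig_rev x (i :: J)).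
Proof.
have [Jp Jl] := sig_rev_regular J.
have [H _ /(_ x)[H0 HP]] := piecewise_poly_primitive i Jp Jl.
have HE u : 0 <= u <= T -> H x u = sig_rev x (i :: J) u.
  move=> uT /=; rewrite (primitive_RS_integralE (Jl x) (path_lipschitz x i) HP uT).
  by rewrite H0 subr0.
split; first by rewrite -HE ?H0// lexx.
exact: (primitive_ext (fun _ _ => erefl) HE HP).
Qed.

Lemma sig_rev_poly_fun J : poly_fun increment (fun x : E => sig_rev x J T).
Proof.
have [Jp _] := sig_rev_regular J.
have n0 := partition_size_gt0 T_gt0 s_part.
have kn : ((size s).-1 < size s)%N by rewrite prednK.
have [m [q [qp Hq]]] := Jp (Ordinal kn).
under eq_fun => x.
  rewrite Hq; first over.
  by rewrite prednK// node_last lexx andbT; rewrite -[leRHS]node_last node_le// leq_pred.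
by apply: poly_fun_sum => j _; apply: poly_funM => //; exact: poly_fun_cst.
Qed.

(** Shuffles of two words, built from their first letters; for the reversed
    words of [sig_rev] these are the outermost integrations. *)
Fixpoint shuffle (K : Type) (J1 : seq K) : seq K -> seq (seq K) :=
  if J1 is i :: J1' then
    fix shuffle_i J2 :=
      if J2 is j :: J2' then
        map (cons i) (shuffle J1' J2) ++ map (cons j) (shuffle_i J2')
      else [:: J1]
  else fun J2 => [:: J2].

(** Integration by parts.  By the product rule both sides are primitives of
    the same differential, by the induction hypothesis applied to the pairs in
    which one of the words has lost its first letter; both vanish at time 0. *)
Lemma sig_rev_shuffle (x : E) J1 J2 t : 0 <= t <= T ->
  sig_rev x J1 t * sig_rev x J2 t = \sum_(J <- shuffle J1 J2) sig_rev x J t.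
Proof.
elim: J1 J2 t => [|i J1 IH1] J2 t tT; first by rewrite big_seq1 mul1r.
elim: J2 t tT => [|j J2 IH2] t tT; first by rewrite big_seq1 mulr1.
rewrite [shuffle _ _]/= -/(shuffle (i :: J1) J2).
set r1 := shuffle J1 (j :: J2) in IH1 *; set r2 := shuffle (i :: J1) J2 in IH2 *.
set H := sig_rev x (i :: J1); set K := sig_rev x (j :: J2).
pose G u := \sum_(J <- r1) sig_rev x (i :: J) u + \sum_(J <- r2) sig_rev x (j :: J) u.
have [H0 HP] := sig_rev_primitive x i J1; have [K0 KP] := sig_rev_primitive x j J2.
have Hl := sig_rev_lipschitz x (i :: J1); have Kl := sig_rev_lipschitz x (j :: J2).
rewrite big_cat !big_map -/(G t); rewrite -/H -/K in H0 K0 HP KP Hl Kl *.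
have G0 : G 0 = 0.
  rewrite /G !big1 ?addr0// => J _; first exact: (sig_rev_primitive x j J).1.
  exact: (sig_rev_primitive x i J).1.
have IHi u : 0 <= u <= T -> \sum_(J <- r1) sig_rev x J u = sig_rev x J1 u * K u.
  by move=> uT; rewrite IH1.
have IHj u : 0 <= u <= T -> \sum_(J <- r2) sig_rev x J u = H u * sig_rev x J2 u.
  by move=> uT; rewrite IH2.
have D1 : second_order T (fun u v => \sum_(J <- r1) (sig_rev x (i :: J) v
    - sig_rev x (i :: J) u - sig_rev x J u * (coord x i v - coord x i u))).
  exact: (second_order_sum r1 (fun J => (sig_rev_primitive x i J).2)).
have D2 : second_order T (fun u v => \sum_(J <- r2) (sig_rev x (j :: J) v
    - sig_rev x (j :: J) u - sig_rev x J u * (coord x j v - coord x j u))).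
  exact: (second_order_sum r2 (fun J => (sig_rev_primitive x j J).2)).
(* H v K v - H u K u splits into K u dH, H u dK and the second-order term
   dH dK; by the induction hypotheses the first-order parts match those of G. *)
have prim : primitive T (fun=> 0) id (fun u => H u * K u - G u).
  have := second_orderD (second_orderD (second_orderD (second_orderM T_ge0 Kl HP)
    (second_orderM T_ge0 Hl KP)) (second_order_lipschitzM Hl Kl))
    (second_orderZ T_ge0 (-1) (second_orderD D1 D2)).
  apply: second_order_ext => u v u0 uv vT.
  have uT : 0 <= u <= T by rewrite u0 (le_trans uv).
  rewrite !big_split /= !sumrN -!mulr_suml IHi// IHj// /G.
  by ring.
have prim0 : primitive T (fun=> 0) id (fun=> 0 : R).
  by exists 0 => // u v _ _ _; rewrite !mul0r !subr0 normr0.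
have := primitive_unique (lipschitz_upto_cst T 0) (lipschitz_upto_id T) prim prim0 tT.
by rewrite /= G0 H0 mul0r !subr0 => /eqP; rewrite subr_eq0 => /eqP.
Qed.

Lemma sig_rev_time (x : E) m u : 0 <= u <= T ->
  sig_rev x (nseq m (lshift d ord0)) u = (m`!%:R)^-1 * u ^+ m.
Proof.
elim: m u => [|m IH] u uT; first by rewrite /= fact0 invr1 mulr1.
have [J0 JP] := sig_rev_primitive x (lshift d ord0) (nseq m (lshift d ord0)).
have prim : primitive T (fun u => (m`!%:R)^-1 * u ^+ m) id
    (sig_rev x (nseq m.+1 (lshift d ord0))).
  apply: second_order_ext JP => a b a0 ab bT /=.
  by rewrite !path_time IH// a0 (le_trans ab).
have prim' := second_orderZ T_ge0 (m`!%:R)^-1 (monomial_primitive T_ge0 m).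
have {}prim' : primitive T (fun u => (m`!%:R)^-1 * u ^+ m) id
    (fun u => (m.+1`!%:R)^-1 * u ^+ m.+1).
  apply: second_order_ext prim' => a b _ _ _.
  by rewrite factS natrM invfM; ring.
have ml : lipschitz_upto T (fun u => (m`!%:R)^-1 * u ^+ m).
  have [Pl _] := poly_primitive T_ge0 ((m`!%:R)^-1 *: 'X^m : {poly R}).
  by apply: lipschitz_upto_ext Pl => a _; rewrite hornerZ hornerXn.
have := primitive_unique ml (lipschitz_upto_id T) prim prim' uT.
by rewrite J0 expr0n mulr0 !subr0.
Qed.

End PathSignature.

(** * The span of the signature coordinates *)

Section SignatureAlgebra.
Context {R : realType} {T alpha' : R} {d : nat} {x0 : 'rV[R]_d} {s : seq R}.
Hypotheses (T_gt0 : 0 < T) (s_part : itv_partition 0 T s).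
Local Notation E := (path_space T alpha' x0 s).
Local Notation node k := (nth 0 (0 :: s) k).
Local Notation mesh k := (node k.+1 - node k).
Local Notation coord x i := (fun u => path_fun x u 0 i).

Let T_ge0 : 0 <= T. Proof. exact: ltW. Qed.

(** Lists of coefficients and reversed words, with possible repetitions, so that
    sums and shuffle products need no collection of like terms. *)
Definition word_span (F : E -> R) := exists L : seq (R * seq 'I_(1 + d)),
  F = fun x => \sum_(aJ <- L) aJ.1 * sig_rev x aJ.2 T.

(** The coefficient of a word is the sum of the coefficients of its occurrences
    in the list, and the longest word of the list bounds the level; reversal turns
    the words of [sig_rev] into those of [signature]. *)
Lemma word_span_sig_span F : word_span F -> sig_span F.
Proof.
move=> [L ->]; pose N := (\max_(aJ <- L) size aJ.2)%N.
pose l I := \sum_(aJ <- L | aJ.2 == rev I) aJ.1.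
exists N, l; apply/funext => x; rewrite /sig_linear.
have word_coord J : (size J <= N)%N ->
    \sum_(k < N.+1) \sum_(I : k.-tuple 'I_(1 + d))
      (J == rev I)%:R * signature x I T = sig_rev x J T.
  move=> JN; have JN' : (size J < N.+1)%N by [].
  have rJ : size (rev J) == size J by rewrite size_rev.
  rewrite (bigD1 (Ordinal JN'))//= (bigD1 (Tuple rJ))//= revK eqxx mul1r.
  rewrite /signature revK big1 ?addr0; last first.
    move=> I IJ; case: eqP => [JI|]; rewrite ?mul0r//.
    by case/eqP: IJ; apply: val_inj;
    by move: (congr1 rev JI); rewrite revK => rJI; exact: esym rJI.
  rewrite big1 ?addr0// => k kJ; rewrite big1// => I _.
  case: eqP => [JI|]; rewrite ?mul0r//; case/eqP: kJ; apply: val_inj => /=.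
  by rewrite (congr1 size JI) size_rev size_tuple.
transitivity (\sum_(aJ <- L) aJ.1 * \sum_(k < N.+1) \sum_(I : k.-tuple 'I_(1 + d))
      (aJ.2 == rev I)%:R * signature x I T).
  rewrite big_seq [RHS]big_seq; apply: eq_bigr => aJ aJL; rewrite word_coord//.
  exact: (@leq_bigmax_seq _ L xpredT (fun aJ => size aJ.2)).
under eq_bigr do rewrite mulr_sumr; rewrite exchange_big; apply: eq_bigr => k _.
under eq_bigr do rewrite mulr_sumr; rewrite exchange_big; apply: eq_bigr => I _.
rewrite /l mulr_suml [RHS]big_mkcond /=; apply: eq_bigr => aJ _.
by case: eqP => _; rewrite ?mul1r// mul0r mulr0.
Qed.

Lemma word_spanZ a F : word_span F -> word_span (fun x => a * F x).
Proof.
move=> [L ->]; exists [seq (a * aJ.1, aJ.2) | aJ <- L]; apply/funext => x.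
by rewrite big_map mulr_sumr; apply: eq_bigr => aJ _; rewrite mulrA.
Qed.

Lemma word_span_word J : word_span (fun x => sig_rev x J T).
Proof. by exists [:: (1, J)]; apply/funext => x; rewrite big_seq1 mul1r. Qed.

Lemma word_spanD F G : word_span F -> word_span G -> word_span (fun x => F x + G x).
Proof. by move=> [L ->] [M ->]; exists (L ++ M); apply/funext => x; rewrite big_cat. Qed.

Lemma word_span_sum (K : Type) (r : seq K) (F : K -> E -> R) :
  (forall k, word_span (F k)) -> word_span (fun x => \sum_(k <- r) F k x).
Proof.
move=> HF; elim: r => [|k r IH].
  by exists [::]; apply/funext => x; rewrite !big_nil.
by under eq_fun do rewrite big_cons; exact: word_spanD.
Qed.

Lemma word_spanM F G : word_span F -> word_span G -> word_span (fun x => F x * G x).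
Proof.
move=> [L ->] [M ->].
rewrite (_ : (fun _ => _) = fun x : E => \sum_(aJ <- L) \sum_(bK <- M)
    aJ.1 * (bK.1 * \sum_(J <- shuffle aJ.2 bK.2) sig_rev x J T)).
  apply: word_span_sum => aJ; apply: word_span_sum => bK.
  by do 2! apply: word_spanZ; apply: word_span_sum => J; exact: word_span_word.
apply/funext => x; rewrite mulr_suml; apply: eq_bigr => aJ _.
rewrite mulr_sumr; apply: eq_bigr => bK _.
by rewrite -(sig_rev_shuffle T_gt0 s_part) ?T_ge0 ?lexx//; ring.
Qed.

(** The integral over [0, T] of Q = P' against x_i is, cell by cell, the slope of
    x_i times the increment of P.  Choosing for P the interpolation polynomial that
    jumps from 0 to mesh k across the k-th cell and is level at the other nodes
    isolates the k-th increment.  Since u^m is m! times the coordinate of the word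
    0 ... 0, the same integral is a combination of signature coordinates. *)
Lemma word_span_increment ki : word_span (increment ki).
Proof.
case: ki => k i.
have nodes_uniq : uniq (0 :: s).
  by have [s_path _] := s_part; exact: (lt_sorted_uniq (s := 0 :: s)).
have [P HP] := poly_interpolation
  (fun t => if node k.+1 <= t then mesh k else 0) nodes_uniq.
have Pnode l : (l <= size s)%N -> P.[node l] = if (k < l)%N then mesh k else 0.
  move=> ls; rewrite HP; last by apply: mem_nth.
  case: (ltnP k l) => kl; first by rewrite (node_le s_part).
  rewrite leNgt (le_lt_trans (node_le s_part kl (ltnW (ltn_ord k))))//.
  by rewrite -subr_gt0 (mesh_gt0 s_part).
pose Q := P^`(); pose word m := i :: nseq m (lshift d ord0).
rewrite (_ : increment (k, i) = fun x : E =>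
    \sum_(m < size Q) (Q`_m * m`!%:R) * sig_rev x (word m) T).
  by apply: word_span_sum => m; apply: word_spanZ; exact: word_span_word.
apply/funext => x.
have [Ql _] := poly_primitive T_ge0 Q.
have prim1 : primitive T (horner Q) (coord x i)
    (fun u => \sum_(m < size Q) (Q`_m * m`!%:R) * sig_rev x (word m) u).
  have := primitive_sum T_ge0 (index_enum 'I_(size Q)) (fun m => Q`_m * m`!%:R)
    (fun m => (sig_rev_primitive T_gt0 s_part x i (nseq m (lshift d ord0))).2).
  apply: primitive_ext => // u uT; rewrite horner_coef; apply: eq_bigr => m _.
  by rewrite (sig_rev_time T_gt0 s_part)// mulrA mulfK// pnatr_eq0 -lt0n fact_gt0.
have prim2 := piecewise_primitive T_gt0 s_part x i Ql
  (fun _ => (poly_primitive T_ge0 P).2) (fun _ _ _ => erefl).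
have TT : 0 <= T <= T by rewrite T_ge0 lexx.
have := primitive_unique Ql (path_lipschitz s_part x i) prim1 prim2 TT.
rewrite [X in _ - X]big1; last first.
  by move=> m _; rewrite (sig_rev_primitive T_gt0 s_part x i _).1 mulr0.
rewrite subr0 => ->; rewrite /piecewise_antiderivative -sumrB.
have clampT (l : 'I_(size s)) : clamp (s := s) l T = node l.+1.
  have lT : node l.+1 <= T by rewrite -[leRHS](node_last s_part) (node_le s_part).
  rewrite /clamp (min_idPr lT) (max_idPr _)//.
  by rewrite -subr_ge0 ltW// (mesh_gt0 s_part).
have clamp0 (l : 'I_(size s)) : clamp (s := s) l 0 = node l.
  have /andP[l0 _] := partition_node_itv s_part (ltnW (ltn_ord l)).
  by rewrite /clamp max_l// ge_min l0.
under eq_bigr => l _ do rewrite -mulrBr clampT clamp0 subrr subr0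
  !Pnode ?(ltnW (ltn_ord l))// ltnS.
rewrite (bigD1 k)//= leqnn ltnn subr0 divfK; last first.
  by rewrite gt_eqF// (mesh_gt0 s_part).
rewrite big1 ?addr0// => l lk; rewrite leq_eqVlt.
have /negPf -> : (k : nat) != l by rewrite eq_sym.
by rewrite subrr mulr0.
Qed.

Lemma poly_fun_sig_span : poly_fun increment = @sig_span R T alpha' d x0 s.
Proof.
apply/funext => F; apply/propext; split=> [HF|[N [l ->]]].
  apply: word_span_sig_span; elim: HF => [a|ki|p q _ ? _ ?|p q _ ? _ ?].
  - by have := word_spanZ a (word_span_word [::]); rewrite /= mulr1.
  - exact: word_span_increment.
  - exact: word_spanD.
  - exact: word_spanM.
rewrite /sig_linear; apply: poly_fun_sum => k _; apply: poly_fun_sum => I _.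
by apply: poly_funZ; exact: sig_rev_poly_fun.
Qed.

End SignatureAlgebra.

(** * Compactness and separation in the path space *)

Lemma continuous_ball {R : numDomainType} {U V : pseudoMetricType R} (f : U -> V) :
  (forall x e, 0 < e -> exists2 del, 0 < del &
     forall y, ball x del y -> ball (f x) e (f y)) -> continuous f.
Proof.
move=> Hf x; apply/cvg_ballP => e /(Hf x)[del del0 Hdel].
by apply/nbhs_ballP; exists del.
Qed.

Section PathTopology.
Context {R : realType} {T alpha' : R} {d : nat} {x0 : 'rV[R]_d} {s : seq R}.
Hypotheses (T_gt0 : 0 < T) (s_part : itv_partition 0 T s).
Hypothesis alpha'_le1 : alpha' <= 1.
Local Notation E := (path_space T alpha' x0 s).
Local Notation node k := (nth 0 (0 :: s) k).
Local Notation mesh k := (node k.+1 - node k).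

Let T_ge0 : 0 <= T. Proof. exact: ltW. Qed.

Lemma enorm_le_sum n (v : 'rV[R]_n) : enorm v <= \sum_i `|v 0 i|.
Proof.
rewrite -[leRHS]ger0_norm ?sumr_ge0// -sqrtr_sqr ler_wsqrtr//.
suff [] : 0 <= \sum_i `|v 0 i| /\ \sum_i v 0 i ^+ 2 <= (\sum_i `|v 0 i|) ^+ 2 by [].
elim/big_rec2: _ => [|i a b _ [a0 ab]]; first by rewrite expr0n.
have v0 := normr_ge0 (v 0 i); split; first exact: addr_ge0.
by rewrite -[in leLHS]real_normK ?num_real//; nra.
Qed.

Lemma time_pair_nodes (k : 'I_(size s)) : time_pairs T (node k, node k.+1).
Proof.
have m0 := mesh_gt0 s_part k.
have /andP[k0 _] := partition_node_itv s_part (ltnW (ltn_ord k)).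
have /andP[_ kT] := partition_node_itv s_part (ltn_ord k).
by split => //=; rewrite -subr_gt0.
Qed.

Lemma holder_norm_ub (a : R) (x : E) u v : a <= 1 -> 0 <= u -> u < v -> v <= T ->
  enorm (x v - x u) <= fine (holder_norm T a x) * (v - u) `^ a.
Proof.
move=> a1 u0 uv vT; have vu : 0 < v - u by rewrite subr_gt0.
rewrite -ler_pdivrMr ?powR_gt0// -lee_fin (fineK (holder_norm_fin T_gt0 s_part x a1)).
by apply: ereal_sup_ubound; exists (u, v) => //=; rewrite gtr0_norm.
Qed.

Lemma holder_norm_ge0 (a : R) (x : E) : 0 <= fine (holder_norm T a x).
Proof.
apply: fine_ge0; apply: (@le_trans _ _ (enorm (x T - x 0) / `|T - 0| `^ a)%:E).
  by rewrite lee_fin divr_ge0 ?powR_ge0 ?enorm_ge0.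
by apply: ereal_sup_ubound; exists (0, T).
Qed.

Lemma increment_le_holder (a : R) ki (x : E) : a <= 1 ->
  `|increment ki x| <= fine (holder_norm T a x) * mesh ki.1 `^ a.
Proof.
move=> a1; have [k0 kk kT] := time_pair_nodes ki.1.
apply: le_trans (holder_norm_ub x a1 k0 kk kT).
apply: le_trans _ (entry_le_enorm _ ki.2).
by rewrite /increment !mxE.
Qed.

Lemma increment_continuous ki : continuous (@increment R T alpha' d x0 s ki).
Proof.
apply: (@continuous_ball R) => x e e0; have [k0 kk kT] := time_pair_nodes ki.1.
pose M := mesh ki.1 `^ alpha'; have M0 : 0 < M by rewrite powR_gt0 ?(mesh_gt0 s_part).
exists (e / M) => [|y]; first exact: divr_gt0.
rewrite /ball /= /path_ball => xy.
have : ((enorm ((x (node ki.1.+1) - x (node ki.1))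
    - (y (node ki.1.+1) - y (node ki.1))) / M)%:E < (e / M)%:E)%E.
  apply: le_lt_trans xy; apply: ereal_sup_ubound; exists (node ki.1, node ki.1.+1) => //=.
  by rewrite gtr0_norm ?(mesh_gt0 s_part).
rewrite lte_fin ltr_pM2r ?invr_gt0//; apply: le_lt_trans.
apply: le_trans _ (entry_le_enorm _ ki.2).
by rewrite /increment !mxE.
Qed.

Definition holder_const : R :=
  (1 + d)%:R * (\sum_(k < size s) (mesh k)^-1) * T `^ (1 - alpha').

(** On each cell the difference of the two paths is affine with slope at most
    del / mesh k, and Lipschitz bounds glue; the exponent alpha' <= 1 turns the
    Lipschitz bound into a Hoelder bound. *)
Lemma holder_dist_le_increments (x y : E) (del : R) : 0 <= del ->
  (forall ki, `|increment ki x - increment ki y| <= del) ->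
  (holder_dist T alpha' x y <= (holder_const * del)%:E)%E.
Proof.
move=> del0 Hdel; pose L := \sum_(k < size s) (mesh k)^-1.
have L0 : 0 <= L.
  by apply: sumr_ge0 => k _; rewrite invr_ge0 ltW// (mesh_gt0 s_part).
have lip i u v : 0 <= u -> u <= v -> v <= T ->
    `|(x v 0 i - x u 0 i) - (y v 0 i - y u 0 i)| <= L * del * (v - u).
  move: u v; apply: (partition_glue T_gt0 s_part) => [u m v _ _ _ _ h1 h2|k u v ku uv vk].
    rewrite (_ : _ - _ = (x m 0 i - x u 0 i - (y m 0 i - y u 0 i))
       + (x v 0 i - x m 0 i - (y v 0 i - y m 0 i))); last by ring.
    rewrite (le_trans (ler_normD _ _))// (_ : _ * (v - u) = L * del * (m - u) + L * del * (v - m)).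
      exact: lerD.
    by ring.
  rewrite !(path_affine T_gt0 s_part _ _ ku uv vk) -mulrBl -mulrBl normrM.
  rewrite (ger0_norm (_ : 0 <= v - u)) ?subr_ge0// ler_wpM2r ?subr_ge0//.
  have m0 := mesh_gt0 s_part k.
  rewrite normrM normfV (gtr0_norm m0) mulrC ler_pM ?invr_ge0 ?(ltW m0)//.
  rewrite /L (bigD1 k)//= lerDl; apply: sumr_ge0 => l _.
  by rewrite invr_ge0 ltW// (mesh_gt0 s_part).
apply: ge_ereal_sup => _ [[u v] [/= u0 uv vT] <-]; rewrite lee_fin.
have vu : 0 < v - u by rewrite subr_gt0.
rewrite gtr0_norm// ler_pdivrMr ?powR_gt0// (le_trans (enorm_le_sum _))//.
apply: (@le_trans _ _ ((1 + d)%:R * (L * del * (v - u)))).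
  rewrite (_ : _%:R * _ = \sum_(i < 1 + d) (L * del * (v - u))); last first.
    by rewrite sumr_const card_ord mulr_natl.
  by apply: ler_sum => i _; rewrite !mxE lip// ltW.
rewrite /holder_const -/L -!mulrA ler_wpM2l// ler_wpM2l//.
rewrite [leRHS]mulrCA ler_wpM2l//.
rewrite -[leLHS]powRr1 ?(ltW vu)// -{1}(subrK alpha' 1) powRD; last first.
  by apply/implyP => _; rewrite gt_eqF.
rewrite ler_wpM2r ?powR_ge0// ge0_ler_powR ?subr_ge0 ?nnegrE ?(ltW vu)//.
by rewrite lerBlDr (le_trans vT)// lerDl.
Qed.

(** Equal increments make the Hoelder distance vanish. *)
Lemma increment_inj (x y : E) : (forall ki, increment ki x = increment ki y) -> x = y.
Proof.
move=> xy; apply: (@holder_dist_eq0 _ T alpha' d x0 s T_gt0 s_part alpha').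
apply/eqP; rewrite eq_le; apply/andP; split.
  rewrite -[leRHS](_ : (holder_const * 0)%:E = _); last by rewrite mulr0.
  by apply: holder_dist_le_increments => // ki; rewrite xy subrr normr0.
apply: (@le_trans _ _ (enorm (x T - x 0 - (y T - y 0)) / `|T - 0| `^ alpha')%:E).
  by rewrite lee_fin divr_ge0 ?powR_ge0 ?enorm_ge0.
by apply: ereal_sup_ubound; exists (0, T).
Qed.

(** A function on the whole line taking the prescribed values at t_1, ..., t_n,
    which [index] locates in s; at 0, which is not in s, it takes the value x0. *)
Definition node_values (W : 'rV['rV[R]_d]_(size s)) (t : R) : 'rV[R]_d :=
  if insub (index t s) is Some k then W 0 k else x0.

Lemma node_values0 W : node_values W 0 = x0.
Proof.
rewrite /node_values insubF// index_mem; apply/negbTE/negP => /(nthP 0) [k ks s0].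
have := mesh_gt0 s_part (Ordinal ks); rewrite /= s0.
have /andP[k0 _] := partition_node_itv s_part (ltnW ks).
by move: k0; lra.
Qed.

Definition path_of (W : 'rV['rV[R]_d]_(size s)) : E :=
  PathSpace T alpha' (ex_intro2 _ _ (node_values W) (node_values0 W) erefl).

Lemma path_of_node W (k : 'I_(size s)) :
  path_of W (node k.+1) = row_mx (node k.+1)%:M (W 0 k).
Proof.
rewrite /= /time_extension (interpolation_node (k := k.+1) _ T_gt0 s_part)//.
congr row_mx; rewrite /node_values /= index_uniq//; last first.
  have [s_path _] := s_part.
  by have /andP[] : uniq (0 :: s) by exact: (lt_sorted_uniq (s := 0 :: s)).
by case: insubP => [k' _ kk'|/negP//]; congr (W 0 _); exact: val_inj.
Qed.

(** The time coordinate and the starting point are shared by all paths, so the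
    values of the other coordinates at the nodes determine the increments. *)
Lemma path_of_surj (x : E) : x = path_of (\row_k rsubmx (x (node k.+1))).
Proof.
set W := \row_k _; have xW k i : (k <= size s)%N -> x (node k) 0 i = path_of W (node k) 0 i.
  case: k => [|k] ks; first by rewrite !(path_start T_gt0 s_part).
  rewrite (path_of_node W (Ordinal ks)); case: (split_ordP i) => j ->.
    by rewrite row_mxEl (ord1 j) path_time mxE eqxx mulr1n.
  by rewrite row_mxEr !mxE.
apply: increment_inj => -[k i]; rewrite /increment !xW//.
exact: ltnW.
Qed.

Lemma path_of_continuous : continuous path_of.
Proof.
apply: (@continuous_ball R) => W e e0.
pose del := e / (2 * (holder_const + 1)).
have H0 : 0 <= holder_const.
  rewrite !mulr_ge0 ?powR_ge0//; apply: sumr_ge0 => k _.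
  by rewrite invr_ge0 ltW// (mesh_gt0 s_part).
have del0 : 0 < del by rewrite divr_gt0// mulr_gt0// ltr_wpDl.
exists del => // W' WW'.
have val k i : (k <= size s)%N ->
    `|path_of W (node k) 0 i - path_of W' (node k) 0 i| <= del.
  case: k => [|k] ks.
    by rewrite !(path_start T_gt0 s_part) subrr normr0 ltW.
  rewrite !(path_of_node _ (Ordinal ks)); case: (split_ordP i) => j ->.
    by rewrite !row_mxEl subrr normr0 ltW.
  rewrite !row_mxEr; apply: ltW; exact: ((WW'.2 0 (Ordinal ks)).2 0 j).
rewrite /ball /= /path_ball.
apply: (@le_lt_trans _ _ (holder_const * (2 * del))%:E).
  apply: holder_dist_le_increments => [|[k i]]; first by rewrite mulr_ge0// ltW.
  have := val k.+1 i (ltn_ord k); have := val k i (ltnW (ltn_ord k)).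
  by rewrite /increment !ler_norml => /andP[? ?] /andP[? ?]; apply/andP; split; lra.
rewrite lte_fin /del (_ : _ * _ = holder_const * e / (holder_const + 1)); last first.
  by field; rewrite gt_eqF// ltr_wpDl.
by rewrite ltr_pdivrMr ?ltr_wpDl// mulrC ltr_pM2l// ltrDl.
Qed.

(** A bounded Hoelder norm bounds the values at the nodes, the starting point
    being fixed; such paths are in the image of a compact box under [path_of]. *)
Lemma holder_ball_compact (a r : R) : 0 <= a -> a <= 1 -> exists2 K : set E, compact K &
  forall x : E, fine (holder_norm T a x) <= r -> K x.
Proof.
move=> a0 a1; pose m := \sum_j `|x0 0 j| + r * T `^ a.
pose box : set 'rV['rV[R]_d]_(size s) :=
  [set W | forall k, [set v : 'rV[R]_d | forall j, `[- m, m]%classic (v 0 j)] (W 0 k)].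
exists (path_of @` box).
  apply: continuous_compact; first exact/continuous_subspaceT/path_of_continuous.
  apply: (@rV_compact _ _ (fun=> [set v : 'rV[R]_d |
    forall j, `[- m, m]%classic (v 0 j)])) => k.
  apply: (@rV_compact _ _ (fun=> `[- m, m]%classic)) => j.
  exact: segment_compact.
move=> x xr; exists (\row_k rsubmx (x (node k.+1))); last by rewrite -path_of_surj.
move=> k j /=; rewrite !mxE in_itv /= -ler_norml.
have [k0 kk kT] := time_pair_nodes k; have k1 := le_lt_trans k0 kk.
have xk := holder_norm_ub x a1 (lexx 0) k1 kT.
rewrite subr0 in xk.
have := le_trans (entry_le_enorm _ (rshift 1 j)) xk.
rewrite mxE [X in _ + X]mxE (path_start T_gt0 s_part) row_mxEr => xkj.
rewrite -[X in `|X|](subrK (x0 0 j)) addrC (le_trans (ler_normD _ _))// lerD//.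
  by rewrite (bigD1 j)//= lerDl sumr_ge0.
rewrite (le_trans xkj)// ler_pM ?holder_norm_ge0 ?powR_ge0//.
by rewrite ge0_ler_powR ?nnegrE// ltW.
Qed.

End PathTopology.

(** * Density of the signature span *)

Theorem proposition3p1 (R : realType) (T : R) (d : nat) (x0 : 'rV[R]_d)
    (s : seq R) (alpha' alpha beta gamma : R)
    (T_gt0 : 0 < T) (s_part : itv_partition 0 T s)
    (alpha'_ge0 : 0 <= alpha') (alpha'_lt : alpha' < alpha)
    (alpha_le1 : alpha <= 1) (beta_gt0 : 0 < beta) (gamma_ge1 : 1 <= gamma) :
  weighted_dense (path_space T alpha' x0 s)
    (exp_weight alpha beta gamma) sig_span.
Proof.
have a'1 : alpha' <= 1 by rewrite ltW// (lt_le_trans alpha'_lt).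
have a0 : 0 <= alpha by rewrite ltW// (le_lt_trans alpha'_ge0).
rewrite -(poly_fun_sig_span T_gt0 s_part).
pose w (x : path_space T alpha' x0 s) := beta * fine (holder_norm T alpha x) `^ gamma.
have norm_le_w (x : path_space T alpha' x0 s) :
    beta * fine (holder_norm T alpha x) <= beta + w x.
  rewrite /w -[X in X + _]mulr1 -mulrDr ler_wpM2l ?(ltW beta_gt0)//.
  have [le1|gt1] := leP (fine (holder_norm T alpha x)) 1.
    by rewrite (le_trans le1)// lerDl powR_ge0.
  rewrite -[leLHS]powRr1 ?(le_trans ler01 (ltW gt1))//.
  by rewrite (le_trans (ler_powR (ltW gt1) gamma_ge1))// lerDr.
apply: (poly_fun_weighted_dense (w := w)).
- exact: increment_continuous.
- by move=> x; rewrite mulr_ge0 ?powR_ge0 ?ltW.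
- move=> ki; set M := (nth 0 (0 :: s) ki.1.+1 - nth 0 (0 :: s) ki.1) `^ alpha.
  have M0 : 0 < M by rewrite powR_gt0 ?(mesh_gt0 s_part).
  exists (beta / M), beta; split=> [|x]; first exact: divr_gt0.
  apply: le_trans (norm_le_w x); rewrite mulrAC ler_pdivrMr// -mulrA.
  by rewrite ler_wpM2l ?(ltW beta_gt0)// increment_le_holder.
- move=> r; have [K Kc HK] := @holder_ball_compact _ T alpha' d x0 s T_gt0 s_part
    a'1 alpha ((beta + r) / beta) a0 alpha_le1.
  exists K => // x Kx; have [//|wr] := leP r (w x); case: Kx; apply: HK.
  rewrite ler_pdivlMr// mulrC (le_trans (norm_le_w x))// lerD2l.
  exact: ltW.
- move=> x y xy; apply/not_existsP => Hxy; apply: xy.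
  apply: (increment_inj T_gt0 s_part a'1) => ki.
  by have /negP/negPn/eqP := Hxy ki.
Qed.
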